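(* A permutation $\sigma\in S_n$ is rigid if and only if it is smooth. In this case, over any field one can choose a parameter $\lambda$ with coordinates in $\{0,1\}$ (or even the parameter all of whose coordinates equal $1$) such that $S^\sigma_\lambda$ is surjective.
   Context: A permutation is smooth if it avoids the patterns $3412$ and $4231$. Rigidity of $\sigma\in S_n$: let $\Bbbk$ be an algebraically closed field of arbitrary characteristic, $Q$ the quiver $1\to2\to\cdots\to 2n-1$ with preprojective algebra $\Pi$, $M([a,b])$ the representation of $Q$ with a one-dimensional space at each vertex of $[a,b]$, zero elsewhere, and nonzero maps along all arrows inside $[a,b]$, and $M=\bigoplus_{i=1}^nM([i,2n-\sigma_i])$ with underlying graded space $V$. Let $\Lambda(V)$ be the variety of $\Pi$-module structures on $V$, i.e. pairs $(T,B)$, $T_v:V_v\to V_{v+1}$, $B_v:V_{v+1}\to V_v$, with $T_{v-1}B_{v-1}=B_vT_v$ for all $1\le v\le 2n-1$ (maps involving $V_0=V_{2n}=0$ being zero), and $C_\sigma$ the closure of $\{(T,B)\in\Lambda(V):T\cong M\}$, an irreducible component of $\Lambda(V)$. Then $\sigma$ is rigid if there is $x\in C_\sigma$ with $\mathrm{Ext}^1_\Pi(x,x)=0$. The map $S^\sigma_\lambda$: let $X_\sigma=\{(i,k):i<k,\ \sigma_i>\sigma_k\}$ and $Y_\sigma=X_\sigma\sqcup\{(c,c):1\le c\le n\}$. Over a given field let $\mathcal A$ have basis $\alpha_{ij}$, $(i,j)\in Y_\sigma$, and $\mathcal D$ have basis $\beta_{ij}$, $(i,j)\in X_\sigma$.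 For $\lambda=\sum\lambda_{ij}\beta_{ij}\in\mathcal D$, $S^\sigma_\lambda:\mathcal A\to\mathcal D$ is the linear map $$S^\sigma_\lambda(\alpha_{ij})=\sum_{m:(j,m),(i,m)\in X_\sigma}\lambda_{jm}\beta_{im}-\sum_{l:(l,i),(l,j)\in X_\sigma}\lambda_{li}\beta_{lj}.$$ *)

(* Defs.v *)
From HB Require Import structures.
From mathcomp Require Import all_boot all_order all_algebra all_fingroup.
From mathcomp Require Import mpoly.

Set Implicit Arguments.
Unset Strict Implicit.
Unset Printing Implicit Defensive.

Import GRing.Theory.
Local Open Scope ring_scope.

(* Only the relative order of the entries of [p] matters. *)
Definition contains_pattern (n : nat) (s : 'S_n) (p : seq nat) : Prop :=
  exists f : 'I_(size p) -> 'I_n,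
    (forall a b : 'I_(size p), (a < b)%N -> (f a < f b)%N) /\
    (forall a b : 'I_(size p),
       (s (f a) < s (f b))%N = (nth 0 p a < nth 0 p b)%N).

Definition smooth (n : nat) (s : 'S_n) : Prop :=
  ~ contains_pattern s [:: 3; 4; 1; 2]%N /\
  ~ contains_pattern s [:: 4; 2; 3; 1]%N.

(* The quiver is 1 -> 2 -> ... -> m.  A graded space is given by its dimension
   vector [d : nat -> nat], its component at the vertex v being 'cV[k]_(d v);
   it lives on the vertices of the quiver when [supported m d].  All the
   matrices at other places are then empty, which is the convention that maps
   from or to V_0 and V_(m+1) are zero.  A matrix A stands for the linear map
   u |-> A *m u. *)

Definition supported (m : nat) (d : nat -> nat) : Prop :=
  forall v, ~~ (0 < v <= m)%N -> d v = 0%N.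

Definition qrep (k : fieldType) (d : nat -> nat) : Type :=
  forall v : nat, 'M[k]_(d v.+1, d v).

Definition qrep_iso (k : fieldType) (d : nat -> nat) (M N : qrep k d) : Prop :=
  exists g : forall v, 'M[k]_(d v),
    (forall v, g v \in unitmx) /\
    (forall v, g v.+1 *m M v = N v *m g v).

Record drep (k : fieldType) (d : nat -> nat) : Type := DRep {
  drepT : forall v : nat, 'M[k]_(d v.+1, d v);
  drepB : forall v : nat, 'M[k]_(d v, d v.+1)
}.

(* The relation T_(w-1) B_(w-1) = B_w T_w at each vertex w = v + 1 in [1, m].
   For [supported m d], the pairs satisfying it are the modules over the
   preprojective algebra with underlying graded space d, i.e. the points of the
   variety Lambda(V). *)
Definition preproj (k : fieldType) (m : nat) (d : nat -> nat)
    (x : drep k d) : Prop :=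
  forall v : nat, (v < m)%N ->
    drepT x v *m drepB x v = drepB x v.+1 *m drepT x v.+1.

Definition drep_hom (k : fieldType) (d e : nat -> nat)
    (x : drep k d) (y : drep k e) (phi : forall v, 'M[k]_(e v, d v)) : Prop :=
  forall v : nat,
    phi v.+1 *m drepT x v = drepT y v *m phi v /\
    phi v *m drepB x v = drepB y v *m phi v.+1.

Definition drep_sum (k : fieldType) (d e : nat -> nat)
    (x : drep k d) (y : drep k e) : drep k (fun v => d v + e v)%N :=
  @DRep k (fun v => d v + e v)%N
    (fun v => block_mx (drepT x v) 0 0 (drepT y v))
    (fun v => block_mx (drepB x v) 0 0 (drepB y v)).

Definition short_exact (k : fieldType) (d e f : nat -> nat)
    (iota : forall v, 'M[k]_(e v, d v)) (pi : forall v, 'M[k]_(f v, e v)) :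
    Prop :=
  forall v : nat,
    [/\ forall u : 'cV[k]_(d v), iota v *m u = 0 -> u = 0,
        forall u : 'cV[k]_(e v),
          pi v *m u = 0 <-> exists w : 'cV[k]_(d v), u = iota v *m w
      & forall w : 'cV[k]_(f v), exists u : 'cV[k]_(e v), pi v *m u = w].

(* [E], with [iota] and [pi], is an extension 0 -> y -> E -> x -> 0 of modules
   over the preprojective algebra. *)
Definition extension (k : fieldType) (m : nat) (d f e : nat -> nat)
    (x : drep k d) (y : drep k f) (E : drep k e)
    (iota : forall v, 'M[k]_(e v, f v)) (pi : forall v, 'M[k]_(d v, e v)) :
    Prop :=
  [/\ supported m e, preproj m E, drep_hom y E iota, drep_hom E x pi
    & short_exact iota pi].

(* Ext^1(x, y) = 0, for the Yoneda Ext^1: every extension of x by y is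
   equivalent to the trivial one 0 -> y -> y (+) x -> x -> 0, whose class is the
   zero of Ext^1(x, y). *)
Definition Ext1_vanishes (k : fieldType) (m : nat) (d f : nat -> nat)
    (x : drep k d) (y : drep k f) : Prop :=
  forall (e : nat -> nat) (E : drep k e)
    (iota : forall v, 'M[k]_(e v, f v)) (pi : forall v, 'M[k]_(d v, e v)),
    extension m x y E iota pi ->
    exists phi : forall v, 'M[k]_(f v + d v, e v),
      [/\ drep_hom E (drep_sum y x) phi,
          forall v, phi v *m iota v = col_mx 1%:M 0
        & forall v, row_mx 0 1%:M *m phi v = pi v].

(* The matrix entries of T_v and of B_v; only v < m matters for
   [supported m d]. *)
Definition coord_index (m : nat) (d : nat -> nat) : finType :=
  ({v : 'I_m & ('I_(d v.+1) * 'I_(d v))%type} +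
   {v : 'I_m & ('I_(d v) * 'I_(d v.+1))%type})%type.

Definition drep_coord (k : fieldType) (m : nat) (d : nat -> nat)
    (x : drep k d) (c : coord_index m d) : k :=
  match c with
  | inl s => drepT x (tag s) (tagged s).1 (tagged s).2
  | inr s => drepB x (tag s) (tagged s).1 (tagged s).2
  end.

Definition poly_eval (k : fieldType) (m : nat) (d : nat -> nat)
    (p : {mpoly k[#|coord_index m d|]}) (x : drep k d) : k :=
  p.@[fun c => drep_coord x (enum_val c)].

Definition zariski_closed (k : fieldType) (m : nat) (d : nat -> nat)
    (Z : drep k d -> Prop) : Prop :=
  exists P : {mpoly k[#|coord_index m d|]} -> Prop,
    forall x, Z x <-> (forall p, P p -> poly_eval p x = 0).

Definition zariski_closure (k : fieldType) (m : nat) (d : nat -> nat)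
    (S : drep k d -> Prop) (x : drep k d) : Prop :=
  forall Z : drep k d -> Prop,
    zariski_closed m Z -> (forall y, S y -> Z y) -> Z x.

Definition interval_dim (a b v : nat) : nat := (a <= v <= b)%N.

Definition interval_rep (k : fieldType) (a b : nat) :
  qrep k (interval_dim a b) := fun v => const_mx 1.

Definition dsum_dim (n : nat) (ds : 'I_n -> nat -> nat) (v : nat) : nat :=
  (\sum_(i < n) ds i v)%N.

(* The cast [conform_mx] is only used when i = j, where it is the identity. *)
Definition qrep_dsum (k : fieldType) (n : nat) (ds : 'I_n -> nat -> nat)
    (Ms : forall i, qrep k (ds i)) : qrep k (dsum_dim ds) :=
  fun v => \mxblock_(i < n, j < n)
    (if i == j
     then conform_mx (0 : 'M[k]_(ds i v.+1, ds j v)) (Ms j v) else 0).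

(* The index i : 'I_n stands for i + 1 in {1, ..., n}, and its image s i for
   (s i) + 1: the interval is [i, 2n - s_i] in 1-based numbering. *)
Definition perm_dim (n : nat) (s : 'S_n) : nat -> nat :=
  dsum_dim (fun i : 'I_n => interval_dim i.+1 (2 * n - (s i).+1)).

Definition perm_rep (k : fieldType) (n : nat) (s : 'S_n) :
    qrep k (perm_dim s) :=
  qrep_dsum (fun i : 'I_n => @interval_rep k i.+1 (2 * n - (s i).+1)).

(* The quiver has m = 2n - 1 vertices. *)
Definition perm_stratum (k : fieldType) (n : nat) (s : 'S_n)
    (x : drep k (perm_dim s)) : Prop :=
  preproj (2 * n).-1 x /\ qrep_iso (drepT x) (perm_rep k s).

Definition perm_component (k : fieldType) (n : nat) (s : 'S_n)
    (x : drep k (perm_dim s)) : Prop :=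
  preproj (2 * n).-1 x /\
  zariski_closure (2 * n).-1 (@perm_stratum k n s) x.

Definition rigid (k : closedFieldType) (n : nat) (s : 'S_n) : Prop :=
  exists x : drep k (perm_dim s),
    perm_component x /\ Ext1_vanishes (2 * n).-1 x x.

Definition Xset (n : nat) (s : 'S_n) : {set 'I_n * 'I_n} :=
  [set p : 'I_n * 'I_n | (p.1 < p.2)%N && (s p.2 < s p.1)%N].

Definition Yset (n : nat) (s : 'S_n) : {set 'I_n * 'I_n} :=
  Xset s :|: [set p : 'I_n * 'I_n | p.1 == p.2].

(* The bases alpha_ij, (i, j) in Y, and beta_ij, (i, j) in X, are realized as
   matrix units. *)
Definition mxspan (F : fieldType) (n : nat) (Z : {set 'I_n * 'I_n}) :
    {vspace 'M[F]_n} :=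
  <<[seq delta_mx p.1 p.2 | p in Z]>>%VS.

Definition Aspace (F : fieldType) (n : nat) (s : 'S_n) : {vspace 'M[F]_n} :=
  mxspan F (Yset s).

Definition Dspace (F : fieldType) (n : nat) (s : 'S_n) : {vspace 'M[F]_n} :=
  mxspan F (Xset s).

Definition Sbasis (F : fieldType) (n : nat) (s : 'S_n) (lam : 'M[F]_n)
    (i j : 'I_n) : 'M[F]_n :=
  \sum_(m | ((j, m) \in Xset s) && ((i, m) \in Xset s))
    lam j m *: delta_mx i m
  - \sum_(l | ((l, i) \in Xset s) && ((l, j) \in Xset s))
    lam l i *: delta_mx l j.

(* The linear extension of alpha_ij |-> Sbasis s lam i j. *)
Definition Smap (F : fieldType) (n : nat) (s : 'S_n) (lam a : 'M[F]_n) :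
    'M[F]_n :=
  \sum_(p in Yset s) a p.1 p.2 *: Sbasis s lam p.1 p.2.

Definition Ssurjective (F : fieldType) (n : nat) (s : 'S_n) (lam : 'M[F]_n) :
    Prop :=
  forall b, b \in Dspace F s -> exists2 a, a \in Aspace F s & Smap s lam a = b.

Definition all_ones (F : fieldType) (n : nat) (s : 'S_n) : 'M[F]_n :=
  \sum_(p in Xset s) delta_mx p.1 p.2.

(* Main.v *)
Require Import Defs.
From HB Require Import structures.
From mathcomp Require Import all_boot all_order all_algebra all_fingroup.
From mathcomp Require Import mpoly zify.
Set Implicit Arguments.
Unset Strict Implicit.
Unset Printing Implicit Defensive.
Import GRing.Theory.
Local Open Scope ring_scope.

(** The pairs (i, j) of X are the strict relations of a partial order P on the
    indices, whose comparabilities are the inversions of the permutation.  So A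
    is the incidence algebra of P, D is the ideal of its strictly triangular
    elements, and S_lambda is the commutator a |-> a lambda - lambda a (lemma
    [Smap_ad]).  Under this dictionary the pattern 4231 is a diamond, two
    incomparable elements with a common lower and a common upper bound, and
    3412 is a butterfly, two incomparable elements that both lie below two
    further incomparable elements.  The theorem follows from three facts.

    Rigidity is surjectivity of some S_lambda.  Self-extensions of a module x
    are computed by the complex End(V) -> pairs (T, B) -> End(V) that
    linearizes the preprojective relation, so Ext^1(x, x) = 0 means exactness
    in the middle ([Ext1_vanishes_exact], [exact_Ext1_vanishes]).  If this
    holds at x, a contracting homotopy at x is still one up to an invertible
    factor wherever a certain determinant is nonzero ([self_ext_exact_open]),
    and such points exist in the stratum T = M when x is in its closure.  Over
    the stratum everything is explicit: all the intervals contain the vertex n,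
    so endomorphisms of M and maps B satisfying the relation are determined by
    their value at n, and these values fill A and D.  Tangent vectors along the
    fibre are exact precisely when S_lambda is onto ([exact_ad_onto]); for the
    converse, the trace form makes the base directions dual to the fibre
    directions, hence exact as well ([ad_onto_exact]).

    A commutator map onto D excludes diamonds and butterflies
    ([ad_onto_not_obstructed]).  Surjectivity passes to convex subsets of P, so
    one may consider an obstructed subset S from which no extremal element can
    be removed.  Then either the Hasse diagram of S has at least #|S| edges,
    whereas modulo products of two strict elements only the diagonal of a
    matters and scalars act trivially, so the image has dimension below #|S|;
    or S consists of a chain with two elements below and two above it, and
    powers of lambda together with the four corner matrix units make the
    kernel larger than #|S|, the dimension that surjectivity prescribes.

    For a smooth permutation lambda = (1, ..., 1) works
    ([smooth_ad_onto_zeta]).  Every nonempty set of indices contains a minimal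
    element with a chain above it, or a maximal element with a chain below it
    ([smooth_chain]).  In the row or column of such an element the matrix units
    are commutators of differences of neighbouring matrix units, and the
    remaining ones are reached by induction. *)

(** * Matrices with prescribed support *)
Section Span.
Variables (F : fieldType) (n : nat).
Implicit Types (Z : {set 'I_n * 'I_n}) (a b : 'M[F]_n).

Lemma mxspan_sum Z a :
  (forall i j, (i, j) \notin Z -> a i j = 0) ->
  a = \sum_(p in Z) a p.1 p.2 *: delta_mx p.1 p.2.
Proof.
move=> aZ; rewrite {1}[a]matrix_sum_delta pair_big /= (bigID (mem Z)) /=.
by rewrite [X in _ + X]big1 ?addr0 // => -[i j] /= /aZ ->; rewrite scale0r.
Qed.

Lemma delta_mxspan Z i j : (i, j) \in Z -> delta_mx i j \in mxspan F Z.
Proof. by move=> ij; apply/memv_span/mapP; exists (i, j); rewrite ?mem_enum. Qed.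

Lemma mxspanP Z a :
  reflect (forall i j, (i, j) \notin Z -> a i j = 0) (a \in mxspan F Z).
Proof.
apply: (iffP idP) => [|aZ]; last first.
  rewrite (mxspan_sum aZ); apply: memv_suml => -[i j] ij.
  exact/memvZ/delta_mxspan.
rewrite /mxspan; set X := [seq _ | _ in _] => aX i j ijZ.
have {aX} := coord_span (X := in_tuple X) aX => ->; rewrite summxE big1 // => l _.
have /imageP[[x y] xyZ /= ->] : (in_tuple X)`_l \in X by rewrite mem_nth.
rewrite !mxE; case: eqP => [ix|]; case: eqP => [jy|] //=; rewrite ?mulr0 //.
by move: ijZ; rewrite ix jy xyZ.
Qed.

Lemma mxspanS Z Z' : Z \subset Z' -> (mxspan F Z <= mxspan F Z')%VS.
Proof.
move=> /subsetP sZ; apply/subvP => a /mxspanP aZ; apply/mxspanP => i j ij.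
by apply: aZ; apply: contra ij; apply: sZ.
Qed.

Lemma dim_mxspan Z : \dim (mxspan F Z) = #|Z|.
Proof.
suff fr : free [seq (delta_mx p.1 p.2 : 'M[F]_n) | p in Z].
  by move: fr; rewrite /free /mxspan => /eqP ->; rewrite size_image.
pose X := [seq (delta_mx p.1 p.2 : 'M[F]_n) | p in Z].
pose q (l : 'I_(size X)) := enum_val (cast_ord (size_image _ _) l).
have XE (l : 'I_(size X)) : (in_tuple X)`_l = delta_mx (q l).1 (q l).2.
  by rewrite -(nth_image 0 (fun p => delta_mx p.1 p.2 : 'M[F]_n)).
apply/(freeP (X := in_tuple X)) => c c0 l.
move/matrixP: c0 => /(_ (q l).1 (q l).2); rewrite summxE (bigD1 l) //= big1.
  by rewrite addr0 !mxE XE mxE !eqxx mulr1.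
move=> l' l'l; rewrite mxE XE mxE -xpair_eqE -!surjective_pairing.
by rewrite (inj_eq enum_val_inj) (inj_eq (@cast_ord_inj _ _ _)) eq_sym (negPf l'l) mulr0.
Qed.

Lemma mulmx_mxspan Z1 Z2 Z3 a b :
  (forall i j l, (i, j) \in Z1 -> (j, l) \in Z2 -> (i, l) \in Z3) ->
  a \in mxspan F Z1 -> b \in mxspan F Z2 -> a *m b \in mxspan F Z3.
Proof.
move=> tr /mxspanP a0 /mxspanP b0; apply/mxspanP => i l il; rewrite mxE big1 // => j _.
case: (boolP ((i, j) \in Z1)) => [ij|/a0 ->]; last by rewrite mul0r.
case: (boolP ((j, l) \in Z2)) => [jl|/b0 ->]; last by rewrite mulr0.
by rewrite (tr _ _ _ ij jl) in il.
Qed.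

Definition ad (lam a : 'M[F]_n) : 'M[F]_n := a *m lam - lam *m a.

Lemma ad_linear lam : linear (ad lam).
Proof.
by move=> c a b; rewrite /ad mulmxDl mulmxDr -scalemxAl -scalemxAr scalerBr opprD addrACA.
Qed.
HB.instance Definition _ lam :=
  GRing.isLinear.Build F 'M[F]_n 'M[F]_n _ (ad lam) (ad_linear lam).
End Span.

(** * Commutators in incidence algebras *)
Section Poset.
Variables (F : fieldType) (n : nat) (lt : rel 'I_n).
Hypothesis lt_trans : transitive lt.
Hypothesis lt_ltn : forall i j, lt i j -> (i < j)%N.
Implicit Types (S : {set 'I_n}) (lam a b : 'M[F]_n).

Definition le i j := (i == j) || lt i j.

Definition incomp i j := [&& i != j, ~~ lt i j & ~~ lt j i].

Definition strict S := [set p : 'I_n * 'I_n | [&& p.1 \in S, p.2 \in S & lt p.1 p.2]].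
Definition weak S := [set p : 'I_n * 'I_n | [&& p.1 \in S, p.2 \in S & le p.1 p.2]].
Definition diagonal S := [set p : 'I_n * 'I_n | (p.1 \in S) && (p.1 == p.2)].

(** For [lam] in the strict part of the incidence algebra of [S]; the reverse
    inclusion then holds by [ad_strict]. *)
Definition ad_onto S lam :=
  (mxspan F (strict S) <= linfun (ad lam) @: mxspan F (weak S))%VS.

Lemma ltxx i : lt i i = false.
Proof. by apply/negP => /lt_ltn; rewrite ltnn. Qed.

Lemma lt_asym i j : lt i j -> lt j i = false.
Proof. by move=> ij; apply/negP => /lt_ltn; have := lt_ltn ij; lia. Qed.

Lemma le_lt_trans j i l : le i j -> lt j l -> lt i l.
Proof. by case/predU1P => [->//|]; apply: lt_trans. Qed.

Lemma lt_le_trans j i l : lt i j -> le j l -> lt i l.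
Proof. by move=> ij /predU1P[<-//|]; apply: lt_trans. Qed.

Lemma strict_sub_weak S : strict S \subset weak S.
Proof.
by apply/subsetP => p; rewrite !inE /le => /and3P[-> -> ->]; rewrite orbT.
Qed.

Lemma weak_strict_mul S a lam :
  a \in mxspan F (weak S) -> lam \in mxspan F (strict S) ->
  a *m lam \in mxspan F (strict S).
Proof.
apply: mulmx_mxspan => i j l; rewrite !inE /= => /and3P[-> _ ij] /and3P[_ -> jl].
exact: le_lt_trans ij jl.
Qed.

Lemma strict_weak_mul S a lam :
  lam \in mxspan F (strict S) -> a \in mxspan F (weak S) ->
  lam *m a \in mxspan F (strict S).
Proof.
apply: mulmx_mxspan => i j l; rewrite !inE /= => /and3P[-> _ ij] /and3P[_ -> jl].
exact: lt_le_trans ij jl.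
Qed.

Lemma ad_strict S a lam :
  lam \in mxspan F (strict S) -> a \in mxspan F (weak S) ->
  ad lam a \in mxspan F (strict S).
Proof.
move=> lamS aS; apply: rpredB; first exact: weak_strict_mul.
exact: strict_weak_mul.
Qed.

Lemma ad_ontoP S lam b : ad_onto S lam -> b \in mxspan F (strict S) ->
  exists2 a, a \in mxspan F (weak S) & ad lam a = b.
Proof.
move=> /subvP onto /onto/memv_imgP[a aS ->]; exists a => //; exact/esym/lfunE.
Qed.

Lemma card_diagonal S : #|diagonal S| = #|S|.
Proof.
rewrite -(card_imset (mem S) (f := fun i => (i, i))) => [|i j [] //].
apply: eq_card => -[i j]; rewrite !inE /=; apply/andP/imsetP.
  by case=> iS /eqP <-; exists i.
by case=> x xS [-> ->].
Qed.

Lemma card_weak S : #|weak S| = (#|S| + #|strict S|)%N.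
Proof.
rewrite -(cardsID (diagonal S)) -(card_diagonal S).
congr (_ + _)%N; apply: eq_card => -[i j]; rewrite !inE /le /=.
  by case: eqP => [->|_]; rewrite ?andbF //=; case: (j \in S).
by case: eqP => [->|]; rewrite ?ltxx ?andbF ?andbT //=; case: (j \in S).
Qed.

Definition restr S a : 'M[F]_n :=
  \matrix_(i, j) (if (i \in S) && (j \in S) then a i j else 0).

Lemma restr_mem (T : {set 'I_n} -> {set 'I_n * 'I_n}) S S' a :
  (forall i j, (i, j) \in T S -> i \in S' -> j \in S' -> (i, j) \in T S') ->
  a \in mxspan F (T S) -> restr S' a \in mxspan F (T S').
Proof.
move=> TS /mxspanP aS; apply/mxspanP => i j ij; rewrite mxE.
by case: ifP => // /andP[iS' jS']; apply: aS; apply: contra ij => /TS; apply.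
Qed.

Lemma restr_strict S S' a :
  a \in mxspan F (strict S) -> restr S' a \in mxspan F (strict S').
Proof.
apply: restr_mem => i j; rewrite !inE /= => /and3P[_ _ ->] -> ->.
by [].
Qed.

(** Cutting matrices down to a convex subset is multiplicative on the incidence
    algebra, because a path between two elements of S' stays in S'. *)
Lemma ad_onto_convex S S' lam : S' \subset S ->
    (forall i j l, i \in S' -> j \in S -> l \in S' -> le i j -> le j l ->
       j \in S') ->
    lam \in mxspan F (strict S) ->
  ad_onto S lam -> ad_onto S' (restr S' lam).
Proof.
move=> /subsetP sS conv /mxspanP lamS onto; apply/subvP => b bS'.
have sS' : strict S' \subset strict S.
  by apply/subsetP => p; rewrite !inE => /and3P[/sS -> /sS -> ->].
have [|a aS ab] := ad_ontoP (b := b) onto.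
  exact: (subvP (mxspanS _ sS')).
apply/memv_imgP; exists (restr S' a).
  apply: restr_mem aS => i j; rewrite !inE /= => /and3P[_ _ ->] -> ->.
  by [].
move/mxspanP: aS => aS; rewrite lfunE /=; apply/matrixP => i l.
case: (boolP ((i \in S') && (l \in S'))) => [/andP[iS' lS']|il]; last first.
  rewrite (mxspanP _ _ bS'); last by apply: contra il; rewrite inE andbA => /andP[].
  rewrite !mxE !big1 ?subr0 // => j _; rewrite !mxE.
    case: ifP; case: ifP => [|_]; rewrite ?mul0r ?mulr0 // => /andP[_ lS'] /andP[iS' _].
    by rewrite iS' lS' in il.
  case: ifP; case: ifP => [|_]; rewrite ?mul0r ?mulr0 // => /andP[_ lS'] /andP[iS' _].
  by rewrite iS' lS' in il.
rewrite -ab !mxE; congr (_ - _); apply: eq_bigr => j _; rewrite !mxE iS' lS' /= andbT.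
  case: ifP => // jS'; rewrite mul0r; case: (boolP ((i, j) \in weak S)) => [|/aS ->];
    last by rewrite mul0r.
  case: (boolP ((j, l) \in strict S)) => [|/lamS ->]; last by rewrite mulr0.
  rewrite !inE /= => /and3P[jS _ jl] /and3P[_ _ ij].
  by rewrite (conv i j l) // in jS'; rewrite /le jl orbT.
case: ifP => // jS'; rewrite mul0r; case: (boolP ((j, l) \in weak S)) => [|/aS ->];
  last by rewrite mulr0.
case: (boolP ((i, j) \in strict S)) => [|/lamS ->]; last by rewrite mul0r.
rewrite !inE /= => /and3P[_ jS ij] /and3P[_ _ jl].
by rewrite (conv i j l) // in jS'; rewrite /le ij orbT.
Qed.

Definition covers S :=
  [set p in strict S | ~~ [exists k in S, lt p.1 k && lt k p.2]].

Lemma coversN S i j k : (i, j) \in covers S -> k \in S -> lt i k -> lt k j -> False.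
Proof.
rewrite inE => /andP[_ /existsPn/(_ k)]; rewrite /= => + kS ik kj.
by rewrite kS ik kj.
Qed.

(** At a covering pair (i, j) the commutator has the entry
    (a i i - a j j) * lam i j, the other terms passing through an element
    strictly between. *)
Lemma ad_onto_covers S lam i j : lam \in mxspan F (strict S) ->
  ad_onto S lam -> (i, j) \in covers S -> lam i j != 0.
Proof.
move=> /mxspanP lamS onto cij; apply/eqP => lam0.
have sij : (i, j) \in strict S by move: cij; rewrite inE => /andP[].
have [a /mxspanP aS /matrixP/(_ i j)] := ad_ontoP onto (delta_mxspan F sij).
rewrite !mxE !eqxx !big1 ?subr0; first by move/esym/eqP; rewrite oner_eq0.
  move=> k _; case: (boolP ((i, k) \in strict S)) => [|/lamS ->]; last by rewrite mul0r.
  case: (boolP ((k, j) \in weak S)) => [|/aS ->]; last by rewrite mulr0.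
  rewrite !inE /= /le => /and3P[kS _ /predU1P[->|kj]]; first by rewrite lam0 mul0r.
  by case/and3P=> _ _ ik; case: (coversN cij kS ik kj).
move=> k _; case: (boolP ((k, j) \in strict S)) => [|/lamS ->]; last by rewrite mulr0.
case: (boolP ((i, k) \in weak S)) => [|/aS ->]; last by rewrite mul0r.
rewrite !inE /= /le => /and3P[_ kS /predU1P[<-|ik]]; first by rewrite lam0 mulr0.
by case/and3P=> _ _ kj; case: (coversN cij kS ik kj).
Qed.

(** Modulo the strict non-covering pairs, the commutator only sees the diagonal
    of [a], and the identity commutes with [lam]: at most #|S| - 1 dimensions
    remain to reach all the covering pairs. *)
Lemma card_covers_lt S lam : lam \in mxspan F (strict S) ->
  (0 < #|S|)%N -> ad_onto S lam -> (#|covers S| < #|S|)%N.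
Proof.
move=> lamS S0 onto; set f := linfun (ad lam).
have oneS : restr S 1%:M \in mxspan F (diagonal S).
  apply/mxspanP => i j; rewrite inE mxE /= => ij; case: ifP => // /andP[iS _].
  by move: ij; rewrite iS mxE => /= /negPf ->.
have one0 : restr S 1%:M != 0.
  have [i iS] := card_gt0P S0; apply/eqP => /matrixP/(_ i i)/eqP.
  by rewrite !mxE iS /= eqxx oner_eq0.
have one_ker : restr S 1%:M \in lker f.
  rewrite memv_ker lfunE /=; apply/eqP/matrixP => i j; rewrite !mxE.
  move/mxspanP: lamS => lamS.
  rewrite (bigD1 i) //= big1 ?addr0 => [|l li]; last first.
    by rewrite !mxE eq_sym (negPf li); case: ifP; rewrite mul0r.
  rewrite [X in _ - X](bigD1 j) //= big1 ?addr0 => [|l lj]; last first.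
    by rewrite !mxE (negPf lj); case: ifP; rewrite mulr0.
  rewrite !mxE !eqxx !andbb; case: (boolP ((i, j) \in strict S)) => [|/lamS ->].
    by rewrite inE /= => /and3P[-> -> _]; rewrite mulr1 mul1r subrr.
  by rewrite mulr0 mul0r subrr.
have dim_diag : (\dim (f @: mxspan F (diagonal S)) < #|S|)%N.
  have /dimvS : (<[restr S 1%:M]> <= mxspan F (diagonal S) :&: lker f)%VS.
    by rewrite subv_cap -!memvE oneS.
  have := limg_ker_dim f (mxspan F (diagonal S)).
  by rewrite dim_vline one0 dim_mxspan card_diagonal => <- ?; rewrite -[ltnLHS]add0n ltn_add2r.
have : (mxspan F (strict S) <=
        f @: mxspan F (diagonal S) + mxspan F (strict S :\: covers S))%VS.
  apply: subv_trans onto _; apply/subvP => _ /memv_imgP[a aS ->].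
  pose a0 := \matrix_(i, j) (if i == j then a i j else 0).
  rewrite -[a](subrK a0) addrC linearD; apply: memv_add.
    apply: memv_img; apply/mxspanP => i j; rewrite inE mxE /= => ij; case: ifP => // /eqP ijE.
    apply: (mxspanP _ _ aS); apply: contra ij; rewrite inE /= => /and3P[-> _ _].
    exact/eqP.
  have a1S : a - a0 \in mxspan F (strict S).
    apply/mxspanP => i j; rewrite inE !mxE /= => ij.
    case: eqP => [|/eqP] ijE; rewrite ?subrr // subr0.
    apply: (mxspanP _ _ aS); apply: contra ij; rewrite inE /= /le (negPf ijE).
    by [].
  have a1W := subvP (mxspanS F (strict_sub_weak S)) _ a1S.
  rewrite [X in X \in _](lfunE _ _); apply/mxspanP => i j;
  rewrite inE negb_and negbK => /orP[cij|ij]; last first.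
    exact: (mxspanP _ _ (ad_strict lamS a1W)).
  rewrite !mxE !big1 ?subr0 // => l _.
    case: (boolP ((i, l) \in strict S)) => [|/(mxspanP _ _ lamS) ->];
      last by rewrite mul0r.
    case: (boolP ((l, j) \in strict S)) => [|/(mxspanP _ _ a1S) ->];
      last by rewrite mulr0.
    rewrite !inE /= => /and3P[lS _ lj] /and3P[_ _ il].
    by case: (coversN cij lS il lj).
  case: (boolP ((i, l) \in strict S)) => [|/(mxspanP _ _ a1S) ->];
    last by rewrite mul0r.
  case: (boolP ((l, j) \in strict S)) => [|/(mxspanP _ _ lamS) ->];
    last by rewrite mulr0.
  rewrite !inE /= => /and3P[lS _ lj] /and3P[_ _ il].
  by case: (coversN cij lS il lj).
move=> /dimvS; rewrite dim_mxspan => dim_le.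
have cs : covers S \subset strict S by apply/subsetP => p; rewrite inE => /andP[].
have := leq_trans dim_le (dimv_add_leqif _ _); rewrite dim_mxspan.
rewrite -(ltn_add2r #|strict S :\: covers S|) in dim_diag.
move=> /leq_ltn_trans/(_ dim_diag).
by rewrite -(cardsID (covers S) (strict S)) (setIidPr cs) ltn_add2r.
Qed.

Definition lower_covers S x := [set y | (y, x) \in covers S].

Lemma coversI S i j : i \in S -> j \in S -> lt i j ->
  (forall k, k \in S -> lt i k -> ~~ lt k j) -> (i, j) \in covers S.
Proof.
move=> iS jS ij no; rewrite !inE /= iS jS ij; apply/existsPn => k /=.
by apply/negP => /andP[kS /andP[ik]]; apply/negP/no.
Qed.

Lemma card_covers S : #|covers S| = (\sum_(x in S) #|lower_covers S x|)%N.
Proof.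
rewrite -sum1_card (partition_big (fun p => p.2) (mem S)) /=; last first.
  by move=> p; rewrite !inE => /andP[/and3P[_ ->]].
apply: eq_bigr => x xS; rewrite sum1dep_card.
rewrite -(card_imset (mem (lower_covers S x)) (f := fun y => (y, x))) => [|i j [] //].
apply: eq_card => -[i j]; rewrite inE /=; apply/andP/imsetP.
  by case=> ij /eqP <-; exists i; rewrite // inE.
by case=> y; rewrite inE => yx [-> ->].
Qed.

(** The candidate with the largest index is a lower cover, the order being
    compatible with the index. *)
Lemma lower_cover_in S x y (Q : pred 'I_n) :
    x \in S -> y \in S -> lt y x -> Q y ->
    (forall i j, Q i -> lt i j -> Q j) ->
  exists2 z, z \in lower_covers S x & Q z.
Proof.
move=> xS yS yx Qy Qup.
case: (arg_maxnP (P := fun i => [&& i \in S, lt i x & Q i])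
                 (fun i : 'I_n => i : nat) (i0 := y)); first by rewrite yS yx.
move=> z /and3P[zS zx Qz] zmax; exists z => //; rewrite inE; apply: coversI => // k kS zk.
apply/negP => kx; have := lt_ltn zk; rewrite ltnNge => /negP; apply.
by apply: zmax; rewrite kS kx (Qup z).
Qed.

Lemma lower_covers_gt0 S x y : x \in S -> y \in S -> lt y x ->
  (0 < #|lower_covers S x|)%N.
Proof.
move=> xS yS yx; have [//|z zx _] := lower_cover_in (Q := predT) xS yS yx isT.
by apply/card_gt0P; exists z.
Qed.

(** If [x] had a single lower cover, it would dominate all the elements
    below [x]. *)
Lemma lower_covers_gt1 S x y : x \in S -> y \in S -> lt y x ->
    (forall p, p \in S -> lt p x ->
       exists z, [/\ z \in S, lt z x & ~~ le z p]) ->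
  (1 < #|lower_covers S x|)%N.
Proof.
move=> xS yS yx two.
have [//|p px _] := lower_cover_in (Q := predT) xS yS yx isT.
have [pS ltpx] : p \in S /\ lt p x by move: px; rewrite !inE => /andP[/and3P[]].
have [z [zS zx zp]] := two p pS ltpx.
have [|q qx qp] := lower_cover_in (Q := fun i => ~~ le i p) xS zS zx zp.
  by move=> i j ip ij; apply: contra ip => jp; rewrite /le (lt_le_trans ij jp) orbT.
apply/card_gt1P; exists p, q; split=> //; apply: contra qp => /eqP ->.
by rewrite /le eqxx.
Qed.

(** Counts the edges of the Hasse diagram by their upper end: each vertex
    without lower cover is compensated by one that has two. *)
Lemma card_le_covers S (A B : {set 'I_n}) :
    A \subset S -> B \subset S -> (#|A| <= #|B|)%N ->
    (forall x, x \in S -> x \notin A -> (0 < #|lower_covers S x|)%N) ->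
    (forall x, x \in B -> (1 < #|lower_covers S x|)%N) ->
  (#|S| <= #|covers S|)%N.
Proof.
move=> AS BS AB pos two; rewrite card_covers.
have sum_ind (C : {set 'I_n}) : C \subset S -> (\sum_(x in S) (x \in C) = #|C|)%N.
  move=> /subsetP CS; rewrite -sum1_card big_mkcond [RHS]big_mkcond.
  by apply: eq_bigr => x _; case: (boolP (x \in C)) => [/CS ->//|_]; case: ifP.
have : (\sum_(x in S) (1 + (x \in B)) <=
        \sum_(x in S) (#|lower_covers S x| + (x \in A)))%N.
  apply: leq_sum => x xS; case: (boolP (x \in B)) => [/two|_]; first by lia.
  by case: (boolP (x \in A)) => [_|/(pos _ xS)]; lia.
rewrite !big_split /= !sum_ind // sum1_card => h; rewrite -(leq_add2r #|B|).
by apply: leq_trans h _; rewrite leq_add2l.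
Qed.

Definition diamond i j k l :=
  [&& incomp j k, lt i j, lt i k, lt j l & lt k l].
Definition butterfly i j k l :=
  [&& incomp i j, incomp k l, lt i k, lt i l, lt j k & lt j l].
Definition obstructed S := exists i j k l,
  [/\ [/\ i \in S, j \in S, k \in S & l \in S]
    & diamond i j k l || butterfly i j k l].

Lemma incompC i j : incomp i j = incomp j i.
Proof. by rewrite /incomp eq_sym [X in _ && X]andbC. Qed.

Definition minimal S x := forall y, y \in S -> ~~ lt y x.
Definition maximal S x := forall y, y \in S -> ~~ lt x y.

Lemma minimal_below S x : x \in S -> exists y, [/\ y \in S, minimal S y & le y x].
Proof.
move=> xS; case: (arg_minnP (P := fun i => (i \in S) && le i x)
                 (fun i : 'I_n => i : nat) (i0 := x)); first by rewrite xS /le eqxx.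
move=> y /andP[yS yx] ymin; exists y; split=> // z zS; apply/negP => zy.
have := lt_ltn zy; by rewrite ltnNge ymin // zS /le (lt_le_trans zy yx) orbT.
Qed.

Lemma maximal_above S x : x \in S -> exists y, [/\ y \in S, maximal S y & le x y].
Proof.
move=> xS; case: (arg_maxnP (P := fun i => (i \in S) && le x i)
                 (fun i : 'I_n => i : nat) (i0 := x)); first by rewrite xS /le eqxx.
move=> y /andP[yS xy] ymax; exists y; split=> // z zS; apply/negP => yz.
have := lt_ltn yz; rewrite ltnNge => /negP; apply; apply: ymax.
by rewrite zS /le (le_lt_trans xy yz) orbT.
Qed.

(** The obstructed posets whose Hasse diagram is a tree: a chain with two minimal
    elements i, j below it and two maximal elements k, l above it.  [R] is the
    chain together with i. *)
Section Kernel.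
Variables (S : {set 'I_n}) (lam : 'M[F]_n) (i j k l : 'I_n).
Hypotheses (lamS : lam \in mxspan F (strict S)) (onto : ad_onto S lam).
Let R := S :\: [set j; k; l].
Hypotheses (iS : i \in S) (jS : j \in S) (kS : k \in S) (lS : l \in S).
Hypotheses (imin : minimal S i) (jmin : minimal S j).
Hypotheses (kmax : maximal S k) (lmax : maximal S l).
Hypotheses (ij : i != j) (kl : k != l).
Hypotheses (ik : lt i k) (il : lt i l) (jk : lt j k) (jl : lt j l).
Hypothesis iR : forall x, x \in R -> le i x.
Hypothesis Rchain : forall x y, x \in R -> y \in R -> le x y || lt y x.

Let height x := #|[set y in R | lt y x]|.
Let power p := iter p (fun N => N *m lam) (restr S 1%:M).

Let i_in_R : i \in R.
Proof.
rewrite !inE iS (negPf ij) andbT /=; apply/norP; split; apply/eqP => e.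
  by move: ik; rewrite e ltxx.
by move: il; rewrite e ltxx.
Qed.

Let one_weak : restr S 1%:M \in mxspan F (weak S).
Proof.
apply/mxspanP => x y; rewrite inE mxE /= => xy; case: ifP => // /andP[xS yS].
by move: xy; rewrite xS yS mxE /= /le; case: eqP.
Qed.

Let one_mul (a : 'M[F]_n) : a \in mxspan F (strict S) ->
  restr S 1%:M *m a = a /\ a *m restr S 1%:M = a.
Proof.
move=> /mxspanP aS; split; apply/matrixP => x y; rewrite !mxE.
  rewrite (bigD1 x) //= big1 ?addr0 => [|z zx]; last first.
    by rewrite !mxE eq_sym (negPf zx); case: ifP; rewrite mul0r.
  rewrite !mxE eqxx andbb; case: (boolP ((x, y) \in strict S)) => [|/aS ->].
    by rewrite inE /= => /and3P[-> _ _]; rewrite mul1r.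
  by rewrite mulr0.
rewrite (bigD1 y) //= big1 ?addr0 => [|z zx]; last first.
  by rewrite !mxE (negPf zx); case: ifP; rewrite mulr0.
rewrite !mxE eqxx andbb; case: (boolP ((x, y) \in strict S)) => [|/aS ->].
  by rewrite inE /= => /and3P[_ -> _]; rewrite mulr1.
by rewrite mul0r.
Qed.

Let power_weak p : power p \in mxspan F (weak S).
Proof.
elim: p => [|p IHp] //=.
exact: subvP (mxspanS F (strict_sub_weak S)) _ (weak_strict_mul IHp lamS).
Qed.

Let power_comm p : ad lam (power p) = 0.
Proof.
elim: p => [|p IHp] /=.
  by rewrite /ad; have [-> ->] := one_mul lamS; rewrite subrr.
rewrite /ad mulmxA -mulmxBl -[X in X *m _]/(ad lam (power p)) IHp; exact: mul0mx.
Qed.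

Let below_in_R x y : x \in S -> y \in R -> le i x -> lt x y -> x \in R.
Proof.
rewrite !inE => xS /andP[_ yS] ix xy; rewrite xS andbT.
apply/norP; split; last by apply/eqP => e; have := lmax yS; rewrite -e xy.
apply/norP; split; last by apply/eqP => e; have := kmax yS; rewrite -e xy.
apply/eqP => e; move: ix; rewrite e /le (negPf ij) /=.
by apply/negP/jmin.
Qed.

Let height_lt x y : x \in R -> lt x y -> (height x < height y)%N.
Proof.
move=> xR xy; apply/proper_card/properP; split.
  by apply/subsetP => z; rewrite !inE => /andP[-> zx]; rewrite (lt_trans zx xy).
by exists x; rewrite inE ?xR ?xy // ltxx andbF.
Qed.

(* On the row of i, a power of [lam] is triangular for the height along the
   chain, with a product of covering coefficients on the diagonal. *)
Let power_row p z : z \in R ->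
  ((height z < p)%N -> power p i z = 0) /\ (height z = p -> power p i z != 0).
Proof.
elim: p z => [|p IHp] z zR; split=> // hz /=.
- have -> : z = i.
    apply/eqP; move: (iR zR); rewrite /le eq_sym => /predU1P[->//|iz].
    by have := height_lt i_in_R iz; rewrite hz.
  by rewrite !mxE iS eqxx oner_eq0.
- rewrite mxE big1 // => w _.
  case: (boolP ((w, z) \in strict S)) => [|/(mxspanP _ _ lamS) ->];
    last by rewrite mulr0.
  case: (boolP ((i, w) \in weak S)) => [|/(mxspanP _ _ (power_weak p)) ->];
    last by rewrite mul0r.
  rewrite !inE /= => /and3P[_ wS iw] /and3P[_ _ wz].
  have wR := below_in_R wS zR iw wz.
  rewrite (IHp w wR).1 ?mul0r //; exact: leq_trans (height_lt wR wz) hz.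
have [w0 [w0R w0z] wmax] : exists2 w, w \in R /\ lt w z &
    forall y, y \in R -> lt y z -> le y w.
  have /card_gt0P[y] : (0 < height z)%N by rewrite hz.
  rewrite inE => /andP[yR yz].
  case: (arg_maxnP (P := fun x => (x \in R) && lt x z)
                 (fun x : 'I_n => x : nat) (i0 := y)); first by rewrite yR.
  move=> w /andP[wR wz] wmax; exists w => // x xR xz.
  case/orP: (Rchain xR wR) => // /lt_ltn; rewrite ltnNge.
  by move/negP => []; apply: wmax; rewrite xR.
have hw0 : height w0 = p.
  apply/eqP; rewrite -eqSS -hz; apply/eqP.
  rewrite /height (cardsD1 w0 [set y in R | lt y z]) inE w0R w0z add1n; congr _.+1.
  apply: eq_card => y; rewrite !inE; apply/andP/andP => [[yR yw]|[yw /andP[yR yz]]].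
    split; first by apply/eqP => e; rewrite e ltxx in yw.
    by rewrite yR (lt_trans yw w0z).
  split=> //; have := wmax y; rewrite !inE => /(_ yR yz).
  by rewrite /le (negPf yw).
have [w0S zS] : w0 \in S /\ z \in S by move: w0R zR; rewrite !inE => /andP[_ ->] /andP[_ ->].
have w0cov : (w0, z) \in covers S.
  apply: coversI => // y yS w0y; apply/negP => yz.
  have iy : le i y by rewrite /le (le_lt_trans (iR w0R) w0y) orbT.
  have := wmax y (below_in_R yS zR iy yz) yz; case/predU1P => [e|/lt_asym].
    by rewrite e ltxx in w0y.
  by rewrite w0y.
rewrite mxE (bigD1 w0) //= big1 ?addr0 => [|w ww0].
  by rewrite mulf_neq0 ?(IHp w0 w0R).2 // (ad_onto_covers lamS onto).
case: (boolP ((w, z) \in strict S)) => [|/(mxspanP _ _ lamS) ->]; last by rewrite mulr0.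
case: (boolP ((i, w) \in weak S)) => [|/(mxspanP _ _ (power_weak p)) ->];
  last by rewrite mul0r.
rewrite !inE /= => /and3P[_ wS iw] /and3P[_ _ wz].
have wR := below_in_R wS zR iw wz.
have ww : lt w w0 by have := wmax w wR wz; rewrite /le (negPf ww0).
by rewrite (IHp w wR).1 ?mul0r // -hw0 height_lt.
Qed.

Let row_proj (a : 'M[F]_n) : 'M[F]_n :=
  \matrix_(x, y) (if (x == i) && (y \in R) then a x y else 0).

Let row_proj_linear : linear row_proj.
Proof. by move=> c a b; apply/matrixP => x y; rewrite !mxE; case: ifP; rewrite ?mulr0 ?addr0. Qed.

Let proj : 'End('M[F]_n) :=
  linfun (HB.pack_for {linear 'M[F]_n -> 'M[F]_n} row_proj
    (GRing.isLinear.Build F 'M[F]_n 'M[F]_n _ row_proj row_proj_linear)).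

Let projE a : proj a = row_proj a.
Proof. by rewrite lfunE. Qed.

Let K := (mxspan F (weak S) :&: lker (linfun (ad lam)))%VS.

Let corner := setX [set i; j] [set k; l].

Let corner_ker : (mxspan F corner <= K :&: lker proj)%VS.
Proof.
have ext x y : x \in [set i; j] -> y \in [set k; l] ->
    [/\ x \in S, y \in S, minimal S x, maximal S y & lt x y].
  by rewrite !inE => /orP[] /eqP -> /orP[] /eqP ->.
apply/subvP => a /mxspanP aC; rewrite !memv_cap !memv_ker -andbA; apply/and3P; split.
- apply/mxspanP => x y xy; apply: aC; apply: contra xy.
  rewrite in_setX => /andP[/ext + /[dup] yC] => /[apply] -[xS yS _ _ xy].
  by rewrite inE /= xS yS /le xy orbT.
- rewrite lfunE /=; apply/eqP/matrixP => x y; rewrite !mxE !big1 ?subr0 // => z _.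
    case: (boolP ((x, z) \in strict S)) => [|/(mxspanP _ _ lamS) ->];
      last by rewrite mul0r.
    case: (boolP ((z, y) \in corner)) => [|/aC ->]; last by rewrite mulr0.
    rewrite in_setX [_ \in strict _]inE => /andP[zC yC] /and3P[xS _ xz].
    by have [_ _ /(_ _ xS)] := ext _ _ zC yC; rewrite xz.
  case: (boolP ((z, y) \in strict S)) => [|/(mxspanP _ _ lamS) ->];
    last by rewrite mulr0.
  case: (boolP ((x, z) \in corner)) => [|/aC ->]; last by rewrite mul0r.
  rewrite in_setX [_ \in strict _]inE => /andP[xC zC] /and3P[_ yS zy].
  by have [_ _ _ /(_ _ yS)] := ext _ _ xC zC; rewrite zy.
- rewrite projE; apply/eqP/matrixP => x y; rewrite !mxE; case: ifP => // /andP[_ yR].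
  apply: aC; rewrite in_setX negb_and; apply/orP; right; move: yR.
  by rewrite !inE => /andP[+ _]; rewrite -orbA !negb_or => /and3P[_ -> ->].
Qed.

Let row_image : (mxspan F (setX [set i] R) <= proj @: K)%VS.
Proof.
have rowE z : z \in R -> delta_mx i z \in (proj @: K)%VS.
  have [m] := ubnP (n - z); elim: m z => // m IHm z; rewrite ltnS => zm zR.
  have KK : power (height z) \in K.
    by rewrite memv_cap power_weak memv_ker lfunE /= power_comm eqxx.
  have := memv_img proj KK; rewrite projE.
  have -> : row_proj (power (height z)) =
      power (height z) i z *: delta_mx i z +
      \sum_(w in R | w != z) power (height z) i w *: delta_mx i w.
    transitivity (\sum_(w in R) power (height z) i w *: (delta_mx i w : 'M[F]_n));
      last by rewrite (bigD1 z).
    apply/matrixP => x y; rewrite summxE mxE.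
    case: ifP => [/andP[/eqP -> yR]|xy].
      rewrite (bigD1 y) //= big1 => [|w /andP[wR wy]];
        first by rewrite !mxE !eqxx mulr1 addr0.
      by rewrite !mxE eqxx eq_sym (negPf wy) mulr0.
    rewrite big1 // => w wR; rewrite !mxE; case: eqP => [xi|]; last by rewrite mulr0.
    case: eqP => [yw|]; last by rewrite mulr0.
    by rewrite xi yw eqxx wR in xy.
  set rest := (X in _ + X) => imz.
  have rest_im : rest \in (proj @: K)%VS.
    apply: memv_suml => w /andP[wR wz]; have [wz'|zw] : lt w z \/ lt z w.
    - have := Rchain wR zR; rewrite /le (negPf wz) /=.
      by case/orP; [left|right].
    - rewrite (power_row _ wR).1 ?scale0r ?mem0v //; exact: height_lt.
    apply/memvZ/IHm => //; apply: leq_trans zm.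
    exact: ltn_sub2l (ltn_trans (lt_ltn zw) (ltn_ord w)) (lt_ltn zw).
  have := power_row (height z) zR => -[_ /(_ erefl) c0].
  rewrite -(scale1r (delta_mx i z)) -(mulVf c0) -scalerA; apply: memvZ.
  by rewrite -(rpredDr _ rest_im).
apply/subvP => a /mxspanP/mxspan_sum ->; apply: memv_suml => -[x y].
by rewrite in_setX inE => /andP[/eqP -> yR]; apply/memvZ/rowE.
Qed.

(** Since #|weak| = #|S| + #|strict|, surjectivity would leave a kernel of
    dimension at most #|S|.  But the kernel contains the four corner matrix
    units, killed by the projection to the row of i, and the powers of [lam],
    whose projections span the #|S| - 3 matrix units of that row in [R]. *)
Lemma ad_not_onto_kernel : False.
Proof.
have dimK : (\dim K + #|strict S| <= #|S| + #|strict S|)%N.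
  have := limg_ker_dim (linfun (ad lam)) (mxspan F (weak S)).
  rewrite [X in _ = X]dim_mxspan (card_weak S) => <-; rewrite leq_add2l.
  by move/dimvS: onto; rewrite dim_mxspan.
have := limg_ker_dim proj K.
have := dimvS row_image; rewrite dim_mxspan cardsX cards1 mul1n => dim_row.
have := dimvS corner_ker; rewrite dim_mxspan cardsX !cards2 ij kl => dim_corner dimE.
have SR : (#|S| <= #|R| + 3)%N.
  rewrite -(cardsID [set j; k; l] S) addnC leq_add2l.
  apply: leq_trans (subset_leq_card (subsetIr _ _)) _.
  by apply: leq_trans (leq_card_setU _ _) _; rewrite cards2 cards1; case: eqP.
move: dimK; rewrite leq_add2r -dimE.
move/(leq_trans (leq_add dim_corner dim_row))/leq_trans/(_ SR).
by rewrite addnC leq_add2l.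
Qed.
End Kernel.

Lemma butterfly_swapl i j k l : butterfly i j k l -> butterfly j i k l.
Proof. by rewrite /butterfly incompC => /and5P[-> -> -> -> /andP[-> ->]]. Qed.

Lemma butterfly_swapr i j k l : butterfly i j k l -> butterfly i j l k.
Proof. by rewrite /butterfly [incomp k l]incompC => /and5P[-> -> -> -> /andP[-> ->]]. Qed.

Lemma ad_onto_del S lam x : lam \in mxspan F (strict S) -> x \in S ->
    minimal S x \/ maximal S x ->
  ad_onto S lam -> ad_onto (S :\ x) (restr (S :\ x) lam).
Proof.
move=> lamS xS ext; apply: ad_onto_convex => //; first exact: subsetDl.
move=> i j l; rewrite !inE => /andP[ix iS] jS /andP[lx lS]; rewrite jS andbT.
move=> /predU1P[<- //|ij] /predU1P[-> //|jl]; apply/eqP => jx.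
by case: ext => ext; [have := ext i iS | have := ext l lS]; rewrite -jx ?ij ?jl.
Qed.

(** By induction on #|S|, so that [S] may be taken minimal among the obstructed
    sets. *)
Theorem ad_onto_not_obstructed S lam :
  lam \in mxspan F (strict S) -> ad_onto S lam -> ~ obstructed S.
Proof.
have [m] := ubnP #|S|; elim: m S lam => // m IHm S lam Sm lamS onto obsS.
have Sn0 : (0 < #|S|)%N.
  by case: obsS => i [_ [_ [_ [[iS _ _ _] _]]]]; apply/card_gt0P; exists i.
(* By minimality, every diamond and every butterfly of S contains all the
   extremal elements of S. *)
have meets i j k l x : i \in S -> j \in S -> k \in S -> l \in S ->
    diamond i j k l || butterfly i j k l ->
    x \in S -> minimal S x \/ maximal S x -> x \in [:: i; j; k; l].
  move=> iS jS kS lS ijkl xS ext; apply: contraT; rewrite !inE !negb_or.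
  move=> /and4P[xi xj xk xl]; suff : ~ obstructed (S :\ x).
    case; exists i, j, k, l; rewrite !inE !(eq_sym _ x) xi xj xk xl iS jS kS lS.
    by split.
  apply: IHm (restr_strict _ lamS) (ad_onto_del lamS xS ext onto).
  by rewrite -ltnS (leq_trans _ Sm) // (cardsD1 x S) xS.
have covers_lt := card_covers_lt lamS Sn0 onto.
(* A diamond i < j, k < l now forces S to be the interval from i to l, and l to
   have two lower covers: a single one would be the top of a diamond avoiding l. *)
have [diam|nodiam] := boolP [exists i in S, exists j in S, exists k in S,
                        exists l in S, diamond i j k l].
  have [i iS /exists_inP[j jS /exists_inP[k kS /exists_inP[l lS D]]]] := exists_inP diam.
  have /and5P[jk ij ik jl kl] := D.
  have il : lt i l := lt_trans ij jl.
  have imin x : x \in S -> le i x.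
    move=> xS; have [y [yS ymin yx]] := minimal_below xS.
    have := meets i j k l y iS jS kS lS _ yS (or_introl ymin); rewrite D => /(_ isT).
    have := ymin i iS; rewrite !inE => iy /or4P[] /eqP e; rewrite e in iy yx => //.
    - by rewrite ij in iy.
    - by rewrite ik in iy.
    by rewrite il in iy.
  have lmax x : x \in S -> maximal S l /\ le x l.
    move=> xS; have [y [yS ymax xy]] := maximal_above xS.
    have := meets i j k l y iS jS kS lS _ yS (or_intror ymax); rewrite D => /(_ isT).
    have := ymax l lS; rewrite !inE => ly /or4P[] /eqP e; rewrite e in ly xy ymax => //.
    - by rewrite il in ly.
    - by rewrite jl in ly.
    by rewrite kl in ly.
  have : (#|S| <= #|covers S|)%N; last by rewrite leqNgt covers_lt.
  apply: (@card_le_covers S [set i] [set l]); rewrite ?sub1set ?cards1 //.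
    move=> x xS; rewrite inE => xi; apply: (lower_covers_gt0 xS iS).
    by have := imin x xS; rewrite /le eq_sym (negPf xi).
  move=> x; rewrite inE => /eqP ->; apply: (lower_covers_gt1 lS iS il) => p pS pl.
  have [jp|jp] := boolP (le j p); last by exists j.
  have [kp|kp] := boolP (le k p); last by exists k.
  have {jp} jp : lt j p.
    case/predU1P: jp => // e; move: kp jk; rewrite -e /incomp /le.
    by case/predU1P => [->|->]; rewrite ?eqxx ?andbF.
  have {kp} kp : lt k p.
    case/predU1P: kp => // e; move: jp jk; rewrite -e /incomp.
    by move=> ->; rewrite andbF.
  have := meets i j k p l iS jS kS pS _ lS (or_intror (lmax l lS).1).
  rewrite {1}/diamond jk ij ik jp kp => /(_ isT); rewrite !inE => /or4P[] /eqP e.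
  - by rewrite e ltxx in il.
  - by rewrite e ltxx in jl.
  - by rewrite e ltxx in kl.
  by rewrite e ltxx in pl.
have {}nodiam i j k l : i \in S -> j \in S -> k \in S -> l \in S -> ~~ diamond i j k l.
  move=> iS jS kS lS; apply: contra nodiam => D.
  apply/exists_inP; exists i => //; apply/exists_inP; exists j => //.
  by apply/exists_inP; exists k => //; apply/exists_inP; exists l.
(* From here on every interval is a chain, and S contains a butterfly. *)
have interval_chain i x y l : i \in S -> x \in S -> y \in S -> l \in S ->
    lt i x -> lt i y -> lt x l -> lt y l -> le x y || lt y x.
  move=> iS xS yS lS ix iy xl yl; have := nodiam i x y l iS xS yS lS.
  by rewrite /diamond ix iy xl yl /incomp /le; case: eqP; case: (lt x y); case: (lt y x).
have bfly_min i j k l : i \in S -> j \in S -> k \in S -> l \in S ->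
    butterfly i j k l -> minimal S i.
  move=> iS jS kS lS B; have [y [yS ymin yi]] := minimal_below iS.
  have := meets i j k l y iS jS kS lS _ yS (or_introl ymin).
  rewrite B orbT => /(_ isT); case/and5P: B => ij _ ik il _.
  rewrite !inE => /or4P[] /eqP e; rewrite e // in ymin yi *.
  - by case/predU1P: yi ij => [->|ji]; rewrite /incomp ?eqxx // ji !andbF.
  - by case/predU1P: yi ik => [->|/lt_asym ->]; rewrite ?ltxx.
  by case/predU1P: yi il => [->|/lt_asym ->]; rewrite ?ltxx.
have bfly_max i j k l : i \in S -> j \in S -> k \in S -> l \in S ->
    butterfly i j k l -> maximal S k.
  move=> iS jS kS lS B; have [y [yS ymax ky]] := maximal_above kS.
  have := meets i j k l y iS jS kS lS _ yS (or_intror ymax).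
  rewrite B orbT => /(_ isT); case/and5P: B => _ kl ik il /andP[jk jl].
  rewrite !inE => /or4P[] /eqP e; rewrite e // in ymax ky *.
  - by case/predU1P: ky ik => [->|/lt_asym ->]; rewrite ?ltxx.
  - by case/predU1P: ky jk => [->|/lt_asym ->]; rewrite ?ltxx.
  by case/predU1P: ky kl => [->|lk]; rewrite /incomp ?eqxx // lk !andbF.
(* If no element lies in the middle of the butterfly, both its upper elements
   have two lower covers, and the Hasse diagram has too many edges. *)
pose central i j k l z := [&& lt i z, lt j z, lt z k & lt z l].
have two_lower i j k l : i \in S -> j \in S -> k \in S -> l \in S ->
    butterfly i j k l -> (forall z, z \in S -> ~~ central i j k l z) ->
    (1 < #|lower_covers S k|)%N.
  move=> iS jS kS lS B noz; have kmax := bfly_max _ _ _ _ iS jS kS lS B.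
  have lmax := bfly_max _ _ _ _ iS jS lS kS (butterfly_swapr B).
  case/and5P: (B) => ij kl ik il /andP[jk jl].
  apply: (lower_covers_gt1 kS iS ik) => p pS pk.
  have [ip|ip] := boolP (le i p); last by exists i.
  have [jp|jp] := boolP (le j p); last by exists j.
  have {}ip : lt i p.
    case/predU1P: ip => // e; move: jp ij; rewrite -e /incomp.
    by case/predU1P => [->|->]; rewrite ?eqxx ?andbF.
  have {}jp : lt j p.
    case/predU1P: jp => // e; move: ip ij; rewrite -e /incomp.
    by move=> ->; rewrite andbF.
  have := noz p pS; rewrite /central ip jp pk /= => pl.
  have pl' : incomp p l.
    rewrite /incomp pl (negPf (lmax p pS)) !andbT; apply/eqP => e.
    by move: kl; rewrite -e /incomp pk !andbF.
  have := meets i j p l k iS jS pS lS _ kS (or_intror kmax).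
  rewrite /butterfly ij pl' ip il jp jl orbT => /(_ isT); rewrite !inE => /or4P[] /eqP e.
  - by rewrite e ltxx in ik.
  - by rewrite e ltxx in jk.
  - by rewrite e ltxx in pk.
  by move: kl; rewrite e /incomp eqxx.
case: obsS => i [j [k [l [[iS jS kS lS]]]]].
rewrite (negPf (nodiam i j k l iS jS kS lS)) /= => B.
have imin := bfly_min _ _ _ _ iS jS kS lS B.
have jmin := bfly_min _ _ _ _ jS iS kS lS (butterfly_swapl B).
have kmax := bfly_max _ _ _ _ iS jS kS lS B.
have lmax := bfly_max _ _ _ _ iS jS lS kS (butterfly_swapr B).
have /and5P[ij kl ik il /andP[jk jl]] := B.
have above x : x \in S -> le i x || le j x.
  move=> xS; have [y [yS ymin yx]] := minimal_below xS.
  have := meets i j k l y iS jS kS lS _ yS (or_introl ymin).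
  rewrite B orbT => /(_ isT); rewrite !inE => /or4P[] /eqP e; rewrite e in ymin yx.
  - by rewrite yx.
  - by rewrite yx orbT.
  - by have := ymin i iS; rewrite ik.
  by have := ymin i iS; rewrite il.
have below x : x \in S -> le x k || le x l.
  move=> xS; have [y [yS ymax xy]] := maximal_above xS.
  have := meets i j k l y iS jS kS lS _ yS (or_intror ymax).
  rewrite B orbT => /(_ isT); rewrite !inE => /or4P[] /eqP e; rewrite e in ymax xy.
  - by have := ymax k kS; rewrite ik.
  - by have := ymax k kS; rewrite jk.
  - by rewrite xy.
  by rewrite xy orbT.
have neq_ij : i != j by case/and3P: ij.
have neq_kl : k != l by case/and3P: kl.
have [/exists_inP[z zS zC]|noz] := boolP [exists z in S, central i j k l z]; last first.
  have {}noz z : z \in S -> ~~ central i j k l z.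
    by move=> zS; apply: contra noz => zC; apply/exists_inP; exists z.
  have : (#|S| <= #|covers S|)%N; last by rewrite leqNgt covers_lt.
  apply: (@card_le_covers S [set i; j] [set k; l]).
  - by rewrite subUset !sub1set iS jS.
  - by rewrite subUset !sub1set kS lS.
  - by rewrite !cards2 neq_ij neq_kl.
  - move=> x xS; rewrite !inE negb_or => /andP[xi xj]; case/orP: (above x xS).
      by rewrite /le eq_sym (negPf xi) => /(lower_covers_gt0 xS iS).
    by rewrite /le eq_sym (negPf xj) => /(lower_covers_gt0 xS jS).
  move=> x; rewrite !inE => /orP[] /eqP ->; first exact: (two_lower i j k l).
  apply: (two_lower i j l k) => //; first exact: butterfly_swapr.
  by move=> z zS; have := noz z zS; rewrite /central [lt z l && _]andbC.
(* If some z lies in the middle, every further x does: comparing x with z in an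
   interval, failure would produce a butterfly that avoids an extremal element. *)
have central_of i' j' k' l' x : i' \in S -> j' \in S -> k' \in S -> l' \in S ->
    butterfly i' j' k' l' -> central i' j' k' l' z -> x \in S -> lt i' x -> lt x k' ->
    central i' j' k' l' x.
  clear -zS meets lt_trans lt_ltn interval_chain bfly_min bfly_max.
  move=> iS jS kS lS B /and4P[iz jz zk zl] xS ix xk.
  have imin := bfly_min _ _ _ _ iS jS kS lS B.
  have jmin := bfly_min _ _ _ _ jS iS kS lS (butterfly_swapl B).
  have kmax := bfly_max _ _ _ _ iS jS kS lS B.
  have lmax := bfly_max _ _ _ _ iS jS lS kS (butterfly_swapr B).
  have /and5P[ij kl ik il /andP[jk jl]] := B.
  rewrite /central ix xk /=.
  have := interval_chain i' x z k' iS xS zS kS ix iz xk zk.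
  case/orP => [/predU1P[->|xz]|zx]; first by rewrite jz zl.
    rewrite (lt_trans xz zl) andbT; apply: contraT => jx.
    have ixj : incomp x j'.
      rewrite /incomp jx (jmin x xS) !andbT; apply/eqP => e.
      by move: ij; rewrite -e /incomp ix !andbF.
    have := meets x j' k' l' i' xS jS kS lS _ iS (or_introl imin).
    rewrite /butterfly ixj kl xk (lt_trans xz zl) jk jl orbT => /(_ isT).
    rewrite !inE => /or4P[] /eqP e.
    - by rewrite e ltxx in ix.
    - by move: ij; rewrite e /incomp eqxx.
    - by rewrite e ltxx in ik.
    by rewrite e ltxx in il.
  rewrite (lt_trans jz zx) /=; apply: contraT => xl.
  have ixl : incomp x l'.
    rewrite /incomp xl (lmax x xS) !andbT; apply/eqP => e.
    by move: kl; rewrite -e /incomp xk !andbF.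
  have := meets i' j' x l' k' iS jS xS lS _ kS (or_intror kmax).
  rewrite /butterfly ij ixl ix il (lt_trans jz zx) jl orbT => /(_ isT).
  rewrite !inE => /or4P[] /eqP e.
  - by rewrite e ltxx in ik.
  - by rewrite e ltxx in jk.
  - by rewrite e ltxx in xk.
  by move: kl; rewrite e /incomp eqxx.
have Rcentral x : x \in S :\: [set j; k; l] -> (x == i) || central i j k l x.
  rewrite !inE => /andP[]; rewrite -orbA !negb_or => /and3P[xj xk xl] xS.
  have [//|xi] := eqVneq x i; rewrite /=.
  have zC' : central j i k l z by move: zC; rewrite /central andbCA.
  have zCr : central i j l k z by move: zC; rewrite /central [lt z k && _]andbC.
  have zCr' : central j i l k z by move: zC'; rewrite /central [lt z k && _]andbC.
  have Bl := butterfly_swapl B.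
  case/orP: (above x xS); rewrite /le eq_sym ?(negPf xi) ?(negPf xj) /= => ix;
    case/orP: (below x xS); rewrite /le ?(negPf xk) ?(negPf xl) /= => xk'.
  - exact: central_of.
  - have := central_of i j l k x iS jS lS kS (butterfly_swapr B) zCr xS ix xk'.
    by rewrite /central [lt x l && _]andbC.
  - have := central_of j i k l x jS iS kS lS Bl zC' xS ix xk'.
    by rewrite /central andbCA.
  have := central_of j i l k x jS iS lS kS (butterfly_swapr Bl) zCr' xS ix xk'.
  by rewrite /central [lt x l && _]andbC andbCA.
apply: (ad_not_onto_kernel lamS onto iS jS kS lS) => //.
  by move=> x /Rcentral/predU1P[->|/and4P[ix _ _ _]]; rewrite /le ?eqxx ?ix ?orbT.
move=> x y xR yR; have xS : x \in S by move: xR; rewrite !inE => /andP[].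
have yS : y \in S by move: yR; rewrite !inE => /andP[].
case/predU1P: (Rcentral x xR) => [->|/and4P[ix _ xk _]].
  by case/predU1P: (Rcentral y yR) => [->|/and4P[iy _ _ _]]; rewrite /le ?eqxx ?iy ?orbT.
case/predU1P: (Rcentral y yR) => [->|/and4P[iy _ yk _]]; first by rewrite ix orbT.
exact: (interval_chain i x y k).
Qed.

Definition zeta S : 'M[F]_n := \matrix_(i, j) ((i, j) \in strict S)%:R.

Lemma zeta_strict S : zeta S \in mxspan F (strict S).
Proof. by apply/mxspanP => i j; rewrite mxE => /negPf ->. Qed.

Lemma mem_ad_img S lam a : a \in mxspan F (weak S) ->
  ad lam a \in (linfun (ad lam) @: mxspan F (weak S))%VS.
Proof. by move=> aS; apply/memv_imgP; exists a => //; rewrite lfunE. Qed.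

(** Extending a preimage of a matrix unit from [S :\ x] to [S] by zeros only
    creates errors in the row and the column of [x]. *)
Lemma ad_onto_zeta_extend S x : x \in S ->
    ad_onto (S :\ x) (zeta (S :\ x)) ->
    (forall i j, (i, j) \in strict S -> (i == x) || (j == x) ->
       delta_mx i j \in (linfun (ad (zeta S)) @: mxspan F (weak S))%VS) ->
  ad_onto S (zeta S).
Proof.
move=> xS onto new; set W := (_ @: _)%VS in new *.
apply/subvP => b /mxspanP/mxspan_sum ->; apply: memv_suml => -[i j] ij /=.
apply: memvZ; have [|old] := boolP ((i == x) || (j == x)); first exact: new.
have ij' : (i, j) \in strict (S :\ x).
  by move: old ij; rewrite negb_or !inE /= => /andP[-> ->].
have [a aS' adE] := ad_ontoP onto (delta_mxspan F ij').
have aS : a \in mxspan F (weak S).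
  apply: subvP aS'; apply: mxspanS; apply/subsetP => p.
  by rewrite !inE => /and3P[/andP[_ ->] /andP[_ ->] ->].
have : ad (zeta S) a - delta_mx i j \in W.
  have /mxspanP adS := ad_strict (zeta_strict S) aS.
  pose T := [set p in strict S | (p.1 == x) || (p.2 == x)].
  suff /mxspanP/mxspan_sum -> : ad (zeta S) a - delta_mx i j \in mxspan F T.
    apply: memv_suml => -[p q] pq; apply: memvZ.
    by move: pq; rewrite inE => /andP[]; apply: new.
  apply/mxspanP => p q; rewrite inE negb_and => /orP[pq|].
    have := adS p q pq; rewrite !mxE => ->.
    case: eqP => [pi|]; case: eqP => [qj|]; rewrite ?subr0 //.
    by rewrite pi qj ij in pq.
  rewrite negb_or /= => /andP[px qx]; rewrite -adE !mxE.
  move/mxspanP: aS' => aS'; apply/eqP; rewrite subr_eq0; apply/eqP.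
  congr (_ - _); apply: eq_bigr => r _; rewrite !mxE !inE /= ?px ?qx /=.
    have [->|//] := eqVneq r x; rewrite aS' ?mul0r //.
    by rewrite !inE eqxx /= andbF.
  have [->|//] := eqVneq r x; rewrite aS' ?mulr0 //.
  by rewrite !inE eqxx.
move=> W2; rewrite -(subKr (ad (zeta S) a) (delta_mx i j)); apply: memvB => //.
exact: mem_ad_img.
Qed.

(** If [p] precedes [j] in the chain above the minimal element [x], then row [p]
    of zeta minus row [j] of zeta is the unit vector at [j]. *)
Lemma delta_row_im S x j : x \in S -> minimal S x ->
    (forall y z, y \in S -> z \in S -> lt x y -> lt x z -> le y z || lt z y) ->
    j \in S -> lt x j ->
  delta_mx x j \in (linfun (ad (zeta S)) @: mxspan F (weak S))%VS.
Proof.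
move=> xS xmin chain jS xj.
case: (arg_maxnP (P := fun y => [&& y \in S, le x y & lt y j])
                 (fun y : 'I_n => y : nat) (i0 := x)).
  by rewrite xS xj /le eqxx.
move=> p /and3P[pS xp pj] pmax.
suff -> : delta_mx x j = ad (zeta S) (delta_mx x p - delta_mx x j).
  apply: mem_ad_img; apply: memvB; apply: delta_mxspan; rewrite inE /= xS.
    by rewrite pS xp.
  by rewrite jS /le xj orbT.
have zx r : zeta S r x = 0.
  by rewrite mxE inE; case: and3P => // -[rS _ rx]; have := xmin r rS; rewrite rx.
rewrite /ad mulmxBr mulmxBl; apply/matrixP => r c; rewrite !mxE.
have mulE y : \sum_l delta_mx x y r l * zeta S l c = (r == x)%:R * zeta S y c.
  rewrite (bigD1 y) //= big1 ?addr0 => [|l ly]; rewrite mxE ?eqxx ?andbT //.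
  by rewrite (negPf ly) andbF mul0r.
have mul0 y : \sum_l zeta S r l * (delta_mx x y : 'M[F]_n) l c = 0.
  rewrite big1 // => l _; rewrite [delta_mx _ _ _ _]mxE.
  by case: eqP => [->|]; rewrite ?zx ?mul0r ?mulr0.
rewrite !mulE !mul0 subrr subr0 -mulrBr; case: eqP => [_|_] /=; rewrite ?mul0r ?mul1r //.
rewrite !mxE !inE /= pS jS /=; case: eqP => [->|/eqP cj].
  by rewrite jS pj ltxx subr0.
case: (boolP (c \in S)) => cS; last by rewrite subrr.
suff -> : lt p c = lt j c by rewrite subrr.
apply/idP/idP => [pc|]; last exact: lt_trans.
have xc := le_lt_trans xp pc; have := chain j c jS cS xj xc.
rewrite /le eq_sym (negPf cj) /=; case/orP => // cj'.
have := lt_ltn pc; rewrite ltnNge => /negP []; apply: pmax.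
by rewrite cS cj' /le xc orbT.
Qed.

Lemma delta_col_im S x j : x \in S -> maximal S x ->
    (forall y z, y \in S -> z \in S -> lt y x -> lt z x -> le y z || lt z y) ->
    j \in S -> lt j x ->
  delta_mx j x \in (linfun (ad (zeta S)) @: mxspan F (weak S))%VS.
Proof.
move=> xS xmax chain jS jx.
case: (arg_minnP (P := fun y => [&& y \in S, le y x & lt j y])
                 (fun y : 'I_n => y : nat) (i0 := x)).
  by rewrite xS jx /le eqxx.
move=> q /and3P[qS qx jq] qmin.
suff -> : delta_mx j x = ad (zeta S) (delta_mx j x - delta_mx q x).
  apply: mem_ad_img; apply: memvB; apply: delta_mxspan; rewrite inE /= xS.
    by rewrite jS /le jx orbT.
  by rewrite qS qx.
have zx c : zeta S x c = 0.
  by rewrite mxE inE; case: and3P => // -[_ cS xc]; have := xmax c cS; rewrite xc.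
rewrite /ad mulmxBr mulmxBl; apply/matrixP => r c; rewrite !mxE.
have mulE y : \sum_l zeta S r l * (delta_mx y x : 'M[F]_n) l c = (c == x)%:R * zeta S r y.
  rewrite (bigD1 y) //= big1 ?addr0 => [|l ly]; rewrite [delta_mx _ _ _ _]mxE ?eqxx.
    by rewrite mulrC.
  by rewrite (negPf ly) mulr0.
have mul0 y : \sum_l (delta_mx y x : 'M[F]_n) r l * zeta S l c = 0.
  rewrite big1 // => l _; rewrite [delta_mx _ _ _ _]mxE.
  by case: (l =P x) => [->|]; rewrite ?zx ?andbF ?mul0r ?mulr0.
rewrite !mulE !mul0 subrr sub0r -mulrBr andbC.
case: eqP => [_|_] /=; rewrite ?mul0r ?oppr0 ?mul1r //.
rewrite !mxE !inE /= qS jS /=; case: eqP => [->|/eqP rj].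
  by rewrite jS jq ltxx sub0r opprK.
case: (boolP (r \in S)) => rS; last by rewrite subrr oppr0.
suff -> : lt r q = lt r j by rewrite subrr oppr0.
apply/idP/idP => [rq|rj']; last exact: lt_trans rj' jq.
have rx := lt_le_trans rq qx; have := chain r j rS jS rx jx.
rewrite /le (negPf rj) /=; case/orP => // jr.
have := lt_ltn rq; rewrite ltnNge => /negP []; apply: qmin.
by rewrite rS jr /le rx orbT.
Qed.
End Poset.

(** * The poset of inversions of a permutation *)
Section Permutation.
Variables (F : fieldType) (n : nat) (s : 'S_n).
Implicit Types (i j k l : 'I_n) (S : {set 'I_n}).

Definition inv_lt i j := (i < j)%N && (s j < s i)%N.

Lemma inv_trans : transitive inv_lt.
Proof. by move=> j i k /andP[ij sij] /andP[jk sjk]; apply/andP; split; lia. Qed.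

Lemma inv_ltn i j : inv_lt i j -> (i < j)%N.
Proof. by case/andP. Qed.

Lemma Xset_strict : Xset s = strict inv_lt [set: 'I_n].
Proof. by apply/setP => p; rewrite !inE. Qed.

Lemma Yset_weak : Yset s = weak inv_lt [set: 'I_n].
Proof. by apply/setP => p; rewrite !inE orbC. Qed.

Lemma all_ones_zeta : all_ones F s = zeta F inv_lt [set: 'I_n].
Proof.
apply/matrixP => i j; rewrite summxE mxE -Xset_strict.
case: (boolP ((i, j) \in Xset s)) => ij.
  rewrite (bigD1 (i, j)) //= big1 ?addr0 => [|[x y] /andP[_ xy]];
    first by rewrite mxE !eqxx.
  by rewrite mxE /= -xpair_eqE eq_sym (negPf xy).
rewrite big1 // => -[x y] xy; rewrite mxE -xpair_eqE /=; case: eqP => // e.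
by rewrite e xy in ij.
Qed.

Lemma Smap_ad (lam a : 'M[F]_n) : lam \in Dspace F s -> a \in Aspace F s ->
  Smap s lam a = ad lam a.
Proof.
move=> /mxspanP lamD /mxspanP aA; rewrite [in RHS](mxspan_sum aA) linear_sum /=.
apply: eq_bigr => -[i j] ij /=; rewrite linearZ /=; congr (_ *: _).
rewrite /Sbasis /ad; congr (_ - _); apply/matrixP => x y; rewrite summxE mxE.
  rewrite [RHS](bigD1 j) //= [in RHS]big1 ?addr0 => [|l lj]; last first.
    by rewrite mxE (negPf lj) andbF mul0r.
  rewrite mxE eqxx andbT; case: (boolP ((j, y) \in Xset s)) => jy; last first.
    rewrite (lamD _ _ jy) mulr0 big1 // => m /andP[jm _]; rewrite !mxE.
    by case: (y =P m) => [e|]; rewrite ?andbF ?mulr0 // e jm in jy *.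
  have iy : (i, y) \in Xset s.
    move: ij jy; rewrite Yset_weak Xset_strict !inE /=; exact: le_lt_trans inv_trans _ _ _.
  rewrite (bigD1 y) /= ?jy ?iy // big1 ?addr0 => [|m /andP[_ my]]; rewrite !mxE.
    by rewrite eqxx andbT mulrC.
  by rewrite (eq_sym y) (negPf my) andbF mulr0.
rewrite [RHS](bigD1 i) //= [in RHS]big1 ?addr0 => [|l li]; last first.
  by rewrite [delta_mx _ _ _ _]mxE (negPf li) mulr0.
rewrite [delta_mx _ _ _ _]mxE eqxx /=.
case: (boolP ((x, i) \in Xset s)) => xi; last first.
  rewrite (lamD _ _ xi) mul0r big1 // => m /andP[mi _]; rewrite !mxE.
  by case: (x =P m) => [e|]; rewrite ?mulr0 // e mi in xi *.
have xj : (x, j) \in Xset s.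
  move: xi ij; rewrite Yset_weak Xset_strict !inE /=; exact: lt_le_trans inv_trans _ _ _.
rewrite (bigD1 x) /= ?xi ?xj // big1 ?addr0 => [|m /andP[_ mx]]; rewrite !mxE.
  by rewrite eqxx.
by rewrite (eq_sym x) (negPf mx) mulr0.
Qed.

Lemma Ssurjective_ad_onto (lam : 'M[F]_n) : lam \in Dspace F s ->
  Ssurjective s lam <-> ad_onto inv_lt [set: 'I_n] lam.
Proof.
move=> lamD; split=> [surj|onto b bD].
  apply/subvP => b; rewrite -Xset_strict => /surj[a aA <-].
  by rewrite (Smap_ad lamD aA); apply: mem_ad_img; rewrite -Yset_weak.
have [|a aA ab] := ad_ontoP (b := b) onto; first by rewrite -Xset_strict.
by rewrite -Yset_weak in aA; exists a => //; rewrite Smap_ad.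
Qed.

Lemma inv_or i j : i != j -> (i < j)%N -> ~~ inv_lt i j -> (s i < s j)%N.
Proof.
move=> ij lt_ij; rewrite /inv_lt lt_ij /= -leqNgt leq_eqVlt => /predU1P[] //.
by move/val_inj/perm_inj/eqP; rewrite (negPf ij).
Qed.

Lemma incomp_order i j : incomp inv_lt i j ->
  (i < j)%N && (s i < s j)%N || (j < i)%N && (s j < s i)%N.
Proof.
case/and3P=> ij nij nji; case: (ltngtP i j) => [lt_ij|lt_ji|/val_inj/eqP];
  last by rewrite (negPf ij).
  by rewrite (inv_or ij).
by rewrite (inv_or _ lt_ji nji) // eq_sym.
Qed.

Lemma contains_4231 i j k l : (i < j)%N -> (j < k)%N -> (k < l)%N ->
    (s l < s j)%N -> (s j < s k)%N -> (s k < s i)%N ->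
  contains_pattern s [:: 4; 2; 3; 1]%N.
Proof.
move=> ij jk kl slj sjk ski; exists (fun a => nth i [:: i; j; k; l] a).
by split=> -[[|[|[|[|a]]]] // ?] [[|[|[|[|b]]]] // ?] /=; lia.
Qed.

Lemma contains_3412 i j k l : (i < j)%N -> (j < k)%N -> (k < l)%N ->
    (s k < s l)%N -> (s l < s i)%N -> (s i < s j)%N ->
  contains_pattern s [:: 3; 4; 1; 2]%N.
Proof.
move=> ij jk kl skl sli sij; exists (fun a => nth i [:: i; j; k; l] a).
by split=> -[[|[|[|[|a]]]] // ?] [[|[|[|[|b]]]] // ?] /=; lia.
Qed.

Lemma not_obstructed_smooth : ~ obstructed inv_lt [set: 'I_n] -> smooth s.
Proof.
have incompI i j : (i < j)%N -> (s i < s j)%N -> incomp inv_lt i j.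
  move=> ij sij; apply/and3P; split; rewrite /inv_lt; try lia.
  by apply/eqP => e; rewrite e ltnn in ij.
move=> nobs; split=> -[f [fmono fs]]; apply: nobs;
  pose o (a : nat) (h : (a < 4)%N) := f (@Ordinal 4 a h);
  exists (o 0 isT), (o 1 isT), (o 2 isT), (o 3 isT); rewrite !inE; split=> //;
  apply/orP; [right; apply/and5P; split | left; apply/and5P; split];
  try (by apply: incompI; [exact: fmono | rewrite fs]);
  try (by apply/andP; split; [exact: fmono | rewrite fs]);
  by apply/andP; split; (apply/andP; split; [exact: fmono | rewrite fs]).
Qed.

(** The candidates are the element [d] with the largest value and the element [e]
    with the largest position.  Two incomparable elements above [d] and two
    incomparable elements below [e] would combine with [d] and [e] into a
    forbidden pattern. *)
Lemma smooth_chain S : smooth s -> (0 < #|S|)%N -> exists2 x, x \in S &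
  (minimal inv_lt S x /\ (forall y z, y \in S -> z \in S -> inv_lt x y -> inv_lt x z ->
                         le inv_lt y z || inv_lt z y)) \/
  (maximal inv_lt S x /\ (forall y z, y \in S -> z \in S -> inv_lt y x -> inv_lt z x ->
                         le inv_lt y z || inv_lt z y)).
Proof.
move=> [no3412 no4231] /card_gt0P[x0 x0S].
case: (arg_maxnP (P := fun x => x \in S) (fun x : 'I_n => s x : nat) x0S) => d dS dmax.
case: (arg_maxnP (P := fun x => x \in S) (fun x : 'I_n => x : nat) x0S) => e eS emax.
have [up|up] := boolP [forall y in S, forall z in S,
    inv_lt d y ==> inv_lt d z ==> (le inv_lt y z || inv_lt z y)].
  exists d => //; left; split=> [y yS|y z yS zS dy dz].
    by apply/negP => /andP[_]; rewrite ltnNge => /negP[]; apply: dmax.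
  by move/forall_inP/(_ y yS)/forall_inP/(_ z zS): up; rewrite dy dz.
have [down|down] := boolP [forall y in S, forall z in S,
    inv_lt y e ==> inv_lt z e ==> (le inv_lt y z || inv_lt z y)].
  exists e => //; right; split=> [y yS|y z yS zS ye ze].
    by apply/negP => /andP[+ _]; rewrite ltnNge => /negP[]; apply: emax.
  by move/forall_inP/(_ y yS)/forall_inP/(_ z zS): down; rewrite ye ze.
have order y z : ~~ (le inv_lt y z || inv_lt z y) ->
    (y < z)%N && (s y < s z)%N || (z < y)%N && (s z < s y)%N.
  by rewrite !negb_or -andbA => yz; apply: incomp_order; rewrite /incomp yz.
have {up} [b [c [bS cS db dc /andP[bc sbc]]]] : exists b c,
    [/\ b \in S, c \in S, inv_lt d b, inv_lt d c & (b < c)%N && (s b < s c)%N].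
  move: up; rewrite negb_forall_in => /exists_inP[y yS].
  rewrite negb_forall_in => /exists_inP[z zS]; rewrite !negb_imply => /and3P[dy dz].
  by move=> /order/orP[] yz; [exists y, z | exists z, y].
have {down} [p [q [pS qS pe qe /andP[pq spq]]]] : exists p q,
    [/\ p \in S, q \in S, inv_lt p e, inv_lt q e & (p < q)%N && (s p < s q)%N].
  move: down; rewrite negb_forall_in => /exists_inP[y yS].
  rewrite negb_forall_in => /exists_inP[z zS]; rewrite !negb_imply => /and3P[ye ze].
  by move=> /order/orP[] yz; [exists y, z | exists z, y].
move: db dc pe qe => /andP[db sdb] /andP[dc sdc] /andP[pe spe] /andP[qe sqe].
have ce : (c <= e)%N := emax c cS.
have sqd : (s q <= s d)%N := dmax q qS.
have neq (x y : 'I_n) : (x : nat) != y -> (s x : nat) != s y.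
  by apply: contra => /eqP/val_inj/perm_inj ->.
have neq' (x y : 'I_n) : (s x : nat) != s y -> (x : nat) != y.
  by apply: contra => /eqP/val_inj ->.
have [seb|sbe] := ltnP (s e) (s b).
  case: no4231; apply: (@contains_4231 d b c e) => //.
  by rewrite ltn_neqAle ce andbT; apply: neq'; lia.
have sbe' : (s b < s e)%N by rewrite ltn_neqAle sbe andbT; apply: neq; lia.
have [dp|pd] := ltnP d p.
  case: no4231; apply: (@contains_4231 d p q e) => //.
  by rewrite ltn_neqAle sqd andbT; apply: neq; lia.
case: no3412; apply: (@contains_3412 p d b e) => //; [|lia|lia].
by rewrite ltn_neqAle pd andbT; apply: neq'; lia.
Qed.

Theorem smooth_ad_onto_zeta S : smooth s -> ad_onto inv_lt S (zeta F inv_lt S).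
Proof.
move=> smooth_s; have [m] := ubnP #|S|; elim: m S => // m IHm S Sm.
have [S0|Sn0] := posnP #|S|.
  apply/subvP => b /mxspanP bS; suff -> : b = 0 by rewrite mem0v.
  apply/matrixP => i j; rewrite mxE bS // inE.
  by move/cards0_eq: S0 => ->; rewrite inE.
have [x xS ext] := smooth_chain smooth_s Sn0.
apply: (ad_onto_zeta_extend inv_trans xS).
  by apply: IHm; rewrite -ltnS (leq_trans _ Sm) // (cardsD1 x S) xS.
move=> i j; rewrite inE /= => /and3P[iS jS ij].
case: ext => -[ext chain] /orP[] /eqP e; rewrite {}e in iS jS ij *.
- exact: (delta_row_im _ inv_trans inv_ltn).
- by have := ext i iS; rewrite ij.
- by have := ext j jS; rewrite ij.
exact: (delta_col_im _ inv_trans inv_ltn).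
Qed.
End Permutation.

(** * Self-extensions and the linearized preprojective relation *)
Section Tangent.
Variables (k : fieldType) (m : nat) (d : nat -> nat).
Implicit Types (x y u : drep k d) (phi : forall v, 'M[k]_(d v)).

(** The derivative of the preprojective relation at [x], in the direction [u]. *)
Definition tangent x u := forall v, (v < m)%N ->
  drepT u v *m drepB x v + drepT x v *m drepB u v =
  drepB u v.+1 *m drepT x v.+1 + drepB x v.+1 *m drepT u v.+1.

(** The derivative of the action of the graded automorphisms on [x]. *)
Definition inner x phi : drep k d := DRep
  (fun v => phi v.+1 *m drepT x v - drepT x v *m phi v)
  (fun v => phi v *m drepB x v - drepB x v *m phi v.+1).

Definition drep_eq x y :=
  (forall v, drepT x v = drepT y v) /\ (forall v, drepB x v = drepB y v).

(** Exactness in the middle of the three-term complex whose middle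
    cohomology is Ext^1(x, x): every first-order deformation is infinitesimally trivial. *)
Definition self_ext_exact x := forall u, tangent x u ->
  exists phi, drep_eq u (inner x phi).

Hypothesis d_supp : supported m d.

(** A tangent vector is the off-diagonal part of a module structure on x (+) x,
    and a splitting of this extension provides the infinitesimal automorphism. *)
Lemma Ext1_vanishes_exact x : preproj m x ->
  Ext1_vanishes m x x -> self_ext_exact x.
Proof.
move=> px van u tu.
pose E := @DRep k (fun v => d v + d v)%N
  (fun v => block_mx (drepT x v) (drepT u v) 0 (drepT x v))
  (fun v => block_mx (drepB x v) (drepB u v) 0 (drepB x v)).
have [|phi [hom_phi iota_phi pi_phi]] := van _ E (fun v => col_mx 1%:M 0) (fun v => row_mx 0 1%:M).
  split.
  - by move=> v /d_supp ->.
  - move=> v vm; rewrite /= !mulmx_block !mulmx0 !mul0mx !addr0 !add0r px //.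
    by rewrite addrC tu // addrC.
  - move=> v; split; rewrite /= mul_col_mx mul_block_col;
      by rewrite !mulmx1 !mulmx0 !mul0mx !mul1mx !addr0.
  - move=> v; split; rewrite /= mul_row_block mul_mx_row;
      by rewrite !mul0mx !mul1mx !mulmx0 !mulmx1 !add0r.
  - move=> v; split.
    + move=> w; rewrite mul_col_mx mul1mx mul0mx.
      by rewrite -[X in _ = X -> _]col_mx0 => /eq_col_mx[].
    + move=> w; rewrite -[w]vsubmxK mul_row_col mul0mx mul1mx add0r; split.
        by move=> ->; exists (usubmx w); rewrite mul_col_mx mul1mx mul0mx.
      by case=> w'; rewrite mul_col_mx mul1mx mul0mx => /eq_col_mx[].
    move=> w; exists (col_mx 0 w); by rewrite mul_row_col mul0mx mul1mx add0r.
have [psi phiE] : exists psi, forall v, phi v = block_mx 1%:M (psi v) 0 1%:M.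
  exists (fun v => ursubmx (phi v)) => v.
  have := iota_phi v; have := pi_phi v.
  rewrite -{1 2}(submxK (phi v)) mul_row_block mul_block_col.
  rewrite !mul0mx !mul1mx !mulmx1 !mulmx0 !add0r !addr0.
  move=> /eq_row_mx[_ e2] /eq_col_mx[e3 e4].
  by rewrite -[LHS]submxK e3 e4 e2.
exists (fun v => - psi v); split=> v /=; have [] := hom_phi v; rewrite !phiE /= !mulmx_block;
  rewrite !mul1mx !mulmx1 !mulmx0 !mul0mx !addr0 !add0r.
  move=> /eq_block_mx[_ e _ _] _; rewrite mulNmx mulmxN opprK addrC.
  by rewrite -e addrK.
by move=> _ /eq_block_mx[_ e _ _]; rewrite mulNmx mulmxN opprK addrC -e addrK.
Qed.

(** Splitting an extension as a sequence of graded vector spaces turns its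
    module structure into a tangent vector, and an infinitesimal automorphism
    corrects the splitting to one of modules. *)
Lemma exact_Ext1_vanishes x : preproj m x ->
  self_ext_exact x -> Ext1_vanishes m x x.
Proof.
move=> px ex e E iota pi [_ pE hom_iota hom_pi sex].
(* t is a graded section of pi, and r the graded retraction of iota that
   vanishes on t. *)
have eq_cV p q (A B : 'M[k]_(p, q)) : (forall w : 'cV_q, A *m w = B *m w) -> A = B.
  by move=> AB; apply/trmx_inj/row_matrixP => j; rewrite -!tr_col !colE AB.
have [t pi_t] : exists t : forall v, 'M_(e v, d v), forall v, pi v *m t v = 1%:M.
  exists (fun v => pinvmx (pi v)) => v.
  apply/mulmxVp/inj_row_free => w w0; have [_ _ surj] := sex v.
  apply/rowP => j; have [z zE] := surj (delta_mx j 0).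
  have := congr1 (mulmx w) zE; rewrite mulmxA w0 mul0mx -colE.
  by move=> /matrixP/(_ 0 0); rewrite !mxE.
have [r0 r0_iota] : exists r0 : forall v, 'M_(d v, e v), forall v, r0 v *m iota v = 1%:M.
  exists (fun v => (pinvmx (iota v)^T)^T) => v.
  apply: trmx_inj; rewrite trmx_mul trmxK trmx1; apply: mulmxVp.
  apply: inj_row_free => w w0; have [inj _ _] := sex v.
  rewrite -[w]trmxK (inj w^T) ?trmx0 // -[iota v]trmxK -trmx_mul w0; exact: trmx0.
pose r v := r0 v *m (1%:M - t v *m pi v).
have pi_iota v : pi v *m iota v = 0.
  apply: eq_cV => w; rewrite mul0mx -mulmxA; have [_ ker _] := sex v.
  by apply/ker; exists w.
have iota_r v : iota v *m r v = 1%:M - t v *m pi v.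
  apply: eq_cV => w; have [_ ker _] := sex v; rewrite -mulmxA /r -(mulmxA (r0 v)).
  have [|w' ->] := (ker ((1%:M - t v *m pi v) *m w)).1.
    by rewrite mulmxA mulmxBr mulmx1 mulmxA pi_t mul1mx subrr mul0mx.
  by rewrite [r0 v *m _]mulmxA r0_iota mul1mx.
have r_iota v : r v *m iota v = 1%:M.
  by rewrite -mulmxA mulmxBl mul1mx -mulmxA pi_iota mulmx0 subr0 r0_iota.
have r_t v : r v *m t v = 0.
  by rewrite -mulmxA mulmxBl mul1mx -mulmxA pi_t mulmx1 subrr mulmx0.
clearbody r.
have decomp v : 1%:M = iota v *m r v + t v *m pi v by rewrite iota_r subrK.
pose u : drep k d := DRep
  (fun v => r v.+1 *m drepT E v *m t v) (fun v => r v *m drepB E v *m t v.+1).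
have uT v : r v.+1 *m drepT E v *m t v = drepT u v by [].
have uB v : r v *m drepB E v *m t v.+1 = drepB u v by [].
clearbody u.
have rT v : r v.+1 *m drepT E v = drepT x v *m r v + drepT u v *m pi v.
  rewrite -[LHS]mulmx1 (decomp v) mulmxDr !mulmxA ?uT ?uB; congr (_ + _).
  have [h _] := hom_iota v; rewrite -[r v.+1 *m _ *m iota v]mulmxA -h.
  by rewrite mulmxA r_iota mul1mx.
have rB v : r v *m drepB E v = drepB x v *m r v.+1 + drepB u v *m pi v.+1.
  rewrite -[LHS]mulmx1 (decomp v.+1) mulmxDr !mulmxA ?uT ?uB; congr (_ + _).
  have [_ h] := hom_iota v; rewrite -[r v *m _ *m iota _]mulmxA -h.
  by rewrite mulmxA r_iota mul1mx.
have piT v : pi v.+1 *m drepT E v = drepT x v *m pi v by have [] := hom_pi v.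
have piB v : pi v *m drepB E v = drepB x v *m pi v.+1 by have [] := hom_pi v.
have [|phi [eT eB]] := ex u.
  move=> v vm.
  have TB : r v.+1 *m (drepT E v *m drepB E v) *m t v.+1 =
      drepT x v *m drepB u v + drepT u v *m drepB x v.
    rewrite mulmxA rT -mulmxA mulmxDl -!mulmxA (mulmxA (r v)) uB.
    by rewrite (mulmxA (pi v)) piB -(mulmxA (drepB x v)) pi_t mulmx1.
  have BT : r v.+1 *m (drepB E v.+1 *m drepT E v.+1) *m t v.+1 =
      drepB x v.+1 *m drepT u v.+1 + drepB u v.+1 *m drepT x v.+1.
    rewrite mulmxA rB -mulmxA mulmxDl -!mulmxA (mulmxA (r v.+2)) uT.
    by rewrite (mulmxA (pi v.+2)) piT -(mulmxA (drepT x v.+1)) pi_t mulmx1.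
  by rewrite addrC -TB (pE v vm) BT addrC.
exists (fun v => col_mx (r v - phi v *m pi v) (pi v)); split.
- move=> v; split; rewrite /= mul_col_mx mul_block_col !mul0mx addr0 add0r.
    rewrite piT mulmxBl rT -mulmxA piT eT /= mulmxBr; congr col_mx.
    by rewrite mulmxBl !mulmxA addrA addrAC addrK.
  rewrite piB mulmxBl rB -mulmxA piB eB /= mulmxBr; congr col_mx.
  by rewrite mulmxBl !mulmxA addrA addrAC addrK.
- by move=> v; rewrite mul_col_mx mulmxBl r_iota -mulmxA pi_iota mulmx0 subr0.
by move=> v; rewrite mul_row_col mul0mx mul1mx add0r.
Qed.

Lemma inner_tangent x phi : preproj m x -> tangent x (inner x phi).
Proof.
move=> px v vm /=; rewrite !mulmxBl !mulmxBr !mulmxA !subrKA.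
by rewrite -!(mulmxA (phi v.+1)) (px v vm).
Qed.

(** * Openness of exactness *)

(** Families of matrices indexed by the vertices are flattened to row vectors,
    so that the differentials of the complex become matrices depending
    polynomially on the module. *)
Definition fam_index (N : nat) (r c : nat -> nat) : finType :=
  {v : 'I_N & ('I_(r v) * 'I_(c v))%type}.

Definition fam_point N r c v (h : (v < N)%N) (i : 'I_(r v)) (j : 'I_(c v)) :
  fam_index N r c := existT (fun v : 'I_N => 'I_(r v) * 'I_(c v))%type (Ordinal h) (i, j).

Definition fam_of N r c (u : 'rV[k]_#|fam_index N r c|) v : 'M[k]_(r v, c v) :=
  \matrix_(i < r v, j < c v) (match decP (@idP (v < N)%N) with
    | left h => u 0 (enum_rank (fam_point h i j))
    | right _ => 0
    end).

Definition fam_vec N r c (A : forall v, 'M[k]_(r v, c v)) : 'rV[k]_#|fam_index N r c| :=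
  \row_(l < #|fam_index N r c|) (let p : fam_index N r c := enum_val l in
    A (tag p) (tagged p).1 (tagged p).2).

Lemma fam_vecK N r c (A : forall v, 'M[k]_(r v, c v)) v :
  ((N <= v)%N -> r v = 0%N \/ c v = 0%N) -> fam_of (fam_vec N A) v = A v.
Proof.
move=> small; apply/matrixP => i j; rewrite mxE; case: decP => [h|/negP].
  by rewrite mxE enum_rankK.
rewrite -leqNgt => /small; have := ltn_ord i; have := ltn_ord j.
by move=> jc ir [] e; [have := leq_trans ir (eq_leq e) | have := leq_trans jc (eq_leq e)].
Qed.

Lemma fam_ofK N r c (u : 'rV[k]_#|fam_index N r c|) : fam_vec N (fam_of u) = u.
Proof.
apply/rowP => l; rewrite mxE -[in RHS](enum_valK l).
case: (enum_val l) => -[v vN] [i j]; rewrite /= mxE; case: decP => // h.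
by rewrite (bool_irrelevance h vN).
Qed.

Lemma fam_of_linear N r c a (u w : 'rV[k]_#|fam_index N r c|) v :
  fam_of (a *: u + w) v = a *: fam_of u v + fam_of w v.
Proof.
apply/matrixP => i j; rewrite !mxE; case: decP => h; first by rewrite !mxE.
by rewrite mulr0 addr0.
Qed.

Lemma fam_vec_linear N r c a (A B C : forall v, 'M[k]_(r v, c v)) :
  (forall v, C v = a *: A v + B v) -> fam_vec N C = a *: fam_vec N A + fam_vec N B.
Proof. by move=> CE; apply/rowP => l; rewrite !mxE /= CE !mxE. Qed.

Lemma fam_vec_ext N r c (A B : forall v, 'M[k]_(r v, c v)) :
  (forall v, A v = B v) -> fam_vec N A = fam_vec N B.
Proof. by move=> AB; apply/rowP => l; rewrite !mxE /= AB. Qed.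

Lemma fam_vec_eq0 N r c (A : forall v, 'M[k]_(r v, c v)) :
  fam_vec N A = 0 <-> forall v, (v < N)%N -> A v = 0.
Proof.
split=> [A0 v vN|A0].
  apply/matrixP => i j; have /rowP/(_ (enum_rank (fam_point vN i j))) := A0.
  by rewrite !mxE enum_rankK.
by apply/rowP => l; rewrite mxE /= A0 ?mxE.
Qed.

Definition drep_vec u := row_mx (fam_vec m (drepT u)) (fam_vec m (drepB u)).
Definition vec_drep w : drep k d := DRep
  (fam_of (lsubmx w : 'rV_#|fam_index m (fun v => d v.+1) d|))
  (fam_of (rsubmx w : 'rV_#|fam_index m d (fun v => d v.+1)|)).

Let d_top v : (m <= v)%N -> d v.+1 = 0%N.
Proof. by move=> mv; apply: d_supp; lia. Qed.

Lemma drep_vecK u : drep_eq (vec_drep (drep_vec u)) u.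
Proof.
by split=> v; rewrite /= ?row_mxKl ?row_mxKr fam_vecK // => /d_top; [left|right].
Qed.

Lemma vec_drepK w : drep_vec (vec_drep w) = w.
Proof. by rewrite /drep_vec /= !fam_ofK hsubmxK. Qed.

Definition defect x u v : 'M[k]_(d v.+1) :=
  drepT u v *m drepB x v + drepT x v *m drepB u v -
  (drepB u v.+1 *m drepT x v.+1 + drepB x v.+1 *m drepT u v.+1).

Definition diff0 x (u : 'rV[k]_#|fam_index m.+1 d d|) := drep_vec (inner x (fam_of u)).
Definition diff1 x w : 'rV[k]_#|fam_index m (fun v => d v.+1) (fun v => d v.+1)| :=
  fam_vec m (defect x (vec_drep w)).

Lemma diff0_linear x : linear (diff0 x).
Proof.
move=> a u w; rewrite /diff0 /drep_vec scale_row_mx add_row_mx.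
by congr row_mx; apply: fam_vec_linear => v /=; rewrite !fam_of_linear;
  rewrite mulmxDl mulmxDr -scalemxAl -scalemxAr scalerBr opprD addrACA.
Qed.

Lemma diff1_linear x : linear (diff1 x).
Proof.
move=> a u w; apply: fam_vec_linear => v.
rewrite /defect /= !linearP /= !fam_of_linear !mulmxDl !mulmxDr -!scalemxAl -!scalemxAr.
by rewrite addrACA [X in _ - X]addrACA opprD [LHS]addrACA scalerBr !scalerDr.
Qed.

HB.instance Definition _ x := GRing.isLinear.Build _ _ _ _ (diff0 x) (diff0_linear x).
HB.instance Definition _ x := GRing.isLinear.Build _ _ _ _ (diff1 x) (diff1_linear x).

Lemma tangentP x u : tangent x u <-> forall v, (v < m)%N -> defect x u v = 0.
Proof. by split=> t v /t; [move=> h; rewrite /defect h subrr | move/subr0_eq]. Qed.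

Lemma drep_eq_tangent x u w : drep_eq u w -> tangent x u -> tangent x w.
Proof. by move=> [eT eB] t v /t; rewrite !eT !eB. Qed.

Lemma exact_kermx x : self_ext_exact x -> (kermx (lin1_mx (diff1 x)) <= lin1_mx (diff0 x))%MS.
Proof.
move=> ex; apply/row_subP => i; set w := row i _.
have w0 : diff1 x w = 0.
  by rewrite -[LHS](mul_rV_lin1 (diff1 x)); apply/sub_kermxP/row_sub.
have /tangentP/ex[phi [eT eB]] := (fam_vec_eq0 _ _).1 w0.
suff -> : w = diff0 x (fam_vec m.+1 phi) by rewrite -(mul_rV_lin1 (diff0 x)) submxMl.
have phiE v : fam_of (fam_vec m.+1 phi) v = phi v.
  by apply: fam_vecK => mv; left; apply: d_supp; lia.
rewrite -[LHS]vec_drepK /drep_vec; congr row_mx; apply: fam_vec_ext => v.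
  by rewrite eT /= !phiE.
by rewrite eB /= !phiE.
Qed.

Lemma kermx_exact x : (kermx (lin1_mx (diff1 x)) <= lin1_mx (diff0 x))%MS -> self_ext_exact x.
Proof.
move=> ker u tu; have [eT eB] := drep_vecK u.
have : (drep_vec u <= kermx (lin1_mx (diff1 x)))%MS.
  apply/sub_kermxP; rewrite mul_rV_lin1 /=; apply/fam_vec_eq0 => v vm.
  have /tangentP -> // : tangent x (vec_drep (drep_vec u)).
  by apply: drep_eq_tangent tu; split=> w; rewrite ?eT ?eB.
move=> /submx_trans/(_ ker)/submxP[p]; rewrite mul_rV_lin1 /= => pE.
exists (fam_of p); have [fT fB] := drep_vecK (inner x (fam_of p)).
by split=> v; rewrite -?eT -?eB pE ?fT ?fB.
Qed.

Lemma diff_mul0 x : preproj m x -> lin1_mx (diff0 x) *m lin1_mx (diff1 x) = 0.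
Proof.
move=> px; apply/row_matrixP => i; rewrite row_mul row0 rowE !mul_rV_lin1 /=.
apply/fam_vec_eq0 => v vm.
have [eT eB] := drep_vecK (inner x (fam_of (delta_mx 0 i))).
have /tangentP -> // : tangent x (vec_drep (drep_vec (inner x (fam_of (delta_mx 0 i))))).
by apply: drep_eq_tangent (inner_tangent _ px); split=> w; rewrite ?eT ?eB.
Qed.

(** Regular functions on the space of all pairs (T, B). *)
Definition polyfun (g : drep k d -> k) := exists p, forall y, g y = poly_eval (m := m) p y.

Lemma polyfunC a : polyfun (fun=> a).
Proof. by exists a%:MP => y; rewrite /poly_eval mevalC. Qed.

Lemma polyfunD g h : polyfun g -> polyfun h -> polyfun (fun y => g y + h y).
Proof. by move=> [p pE] [q qE]; exists (p + q) => y; rewrite /poly_eval mevalD pE qE. Qed.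

Lemma polyfunM g h : polyfun g -> polyfun h -> polyfun (fun y => g y * h y).
Proof. by move=> [p pE] [q qE]; exists (p * q) => y; rewrite /poly_eval mevalM pE qE. Qed.

Lemma polyfunN g : polyfun g -> polyfun (fun y => - g y).
Proof. by move=> [p pE]; exists (- p) => y; rewrite /poly_eval mevalN pE. Qed.

Lemma polyfun_ext g h : g =1 h -> polyfun g -> polyfun h.
Proof. by move=> gh [p pE]; exists p => y; rewrite -gh. Qed.

Lemma polyfun_sum (I : Type) (s : seq I) (P : pred I) g :
  (forall i, P i -> polyfun (g i)) -> polyfun (fun y => \sum_(i <- s | P i) g i y).
Proof.
move=> gP; elim: s => [|i s IH].
  by apply: polyfun_ext (polyfunC 0) => y; rewrite big_nil.
have [Pi|Pi] := boolP (P i).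
  by apply: polyfun_ext (polyfunD (gP i Pi) IH) => y; rewrite big_cons Pi.
by apply: polyfun_ext IH => y; rewrite big_cons (negPf Pi).
Qed.

Lemma polyfun_prod (I : Type) (s : seq I) g :
  (forall i, polyfun (g i)) -> polyfun (fun y => \prod_(i <- s) g i y).
Proof.
move=> gP; elim: s => [|i s IH].
  by apply: polyfun_ext (polyfunC 1) => y; rewrite big_nil.
by apply: polyfun_ext (polyfunM (gP i) IH) => y; rewrite big_cons.
Qed.

Definition polymx p q (A : drep k d -> 'M[k]_(p, q)) := forall i j, polyfun (fun y => A y i j).

Lemma polymxC p q (A : 'M[k]_(p, q)) : polymx (fun=> A).
Proof. by move=> i j; apply: polyfunC. Qed.

Lemma polymxD p q (A B : drep k d -> 'M[k]_(p, q)) :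
  polymx A -> polymx B -> polymx (fun y => A y + B y).
Proof.
by move=> pA pB i j; apply: polyfun_ext (polyfunD (pA i j) (pB i j)) => y; rewrite mxE.
Qed.

Lemma polymxN p q (A : drep k d -> 'M[k]_(p, q)) : polymx A -> polymx (fun y => - A y).
Proof. by move=> pA i j; apply: polyfun_ext (polyfunN (pA i j)) => y; rewrite mxE. Qed.

Lemma polymxM p q r (A : drep k d -> 'M[k]_(p, q)) (B : drep k d -> 'M[k]_(q, r)) :
  polymx A -> polymx B -> polymx (fun y => A y *m B y).
Proof.
move=> pA pB i j; apply: (@polyfun_ext (fun y => \sum_l A y i l * B y l j)).
  by move=> y; rewrite mxE.
by apply: polyfun_sum => l _; apply: polyfunM.
Qed.

Lemma polyfun_det p (A : drep k d -> 'M[k]_p) : polymx A -> polyfun (fun y => \det (A y)).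
Proof.
by move=> pA; apply: polyfun_sum => s _; apply: polyfunM (polyfunC _) _; apply: polyfun_prod.
Qed.

Lemma polymx_drepT v : polymx (fun y => drepT y v).
Proof.
move=> i j; case: (ltnP v m) => [vm|/d_top v0];
  last by have := leq_trans (ltn_ord i) (eq_leq v0).
exists ('X_(enum_rank (inl (existT _ (Ordinal vm) (i, j)) : coord_index m d))) => y.
by rewrite /poly_eval mevalXU enum_rankK.
Qed.

Lemma polymx_drepB v : polymx (fun y => drepB y v).
Proof.
move=> i j; case: (ltnP v m) => [vm|/d_top v0];
  last by have := leq_trans (ltn_ord j) (eq_leq v0).
exists ('X_(enum_rank (inr (existT _ (Ordinal vm) (i, j)) : coord_index m d))) => y.
by rewrite /poly_eval mevalXU enum_rankK.
Qed.

Lemma polymx_fam_vec N r c (A : drep k d -> forall v, 'M[k]_(r v, c v)) :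
  (forall v, polymx (fun y => A y v)) -> polymx (fun y => fam_vec N (A y)).
Proof.
by move=> pA i j; apply: polyfun_ext (pA (tag (enum_val j)) _ _) => y; rewrite mxE.
Qed.

Lemma polymx_diff0 : polymx (fun y => lin1_mx (diff0 y)).
Proof.
move=> i j; apply: (@polyfun_ext (fun y => diff0 y (delta_mx 0 i) 0 j)) => [y|];
  first by rewrite [RHS]mxE.
rewrite /diff0 /drep_vec; case: (split_ordP j) => l ->.
  apply: (@polyfun_ext (fun y => fam_vec m (drepT (inner y (fam_of (delta_mx 0 i)))) 0 l)) => [y|].
    by rewrite row_mxEl.
  apply: polymx_fam_vec => v; apply: polymxD; last apply: polymxN; apply: polymxM;
  by [apply: polymxC | apply: polymx_drepT].
apply: (@polyfun_ext (fun y => fam_vec m (drepB (inner y (fam_of (delta_mx 0 i)))) 0 l)) => [y|].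
  by rewrite row_mxEr.
apply: polymx_fam_vec => v; apply: polymxD; last apply: polymxN; apply: polymxM;
by [apply: polymxC | apply: polymx_drepB].
Qed.

Lemma polymx_diff1 : polymx (fun y => lin1_mx (diff1 y)).
Proof.
move=> i j; apply: (@polyfun_ext (fun y => diff1 y (delta_mx 0 i) 0 j)) => [y|];
  first by rewrite [RHS]mxE.
apply: polymx_fam_vec => v; apply: polymxD; last apply: polymxN;
  apply: polymxD; apply: polymxM;
  by [apply: polymxC | apply: polymx_drepT | apply: polymx_drepB].
Qed.

(** Write D0 and D1 for the differentials.  Exactness at [x] yields h0, h1 with
    h0 D0(x) + D1(x) h1 = 1.  Where the deformed endomorphism
    h0 D0(y) + D1(y) h1 is invertible, it embeds the kernel of D1(y) into the
    image of D0(y), so that the two agree by dimension. *)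
Lemma self_ext_exact_open x : self_ext_exact x ->
  exists2 p, poly_eval (m := m) p x != 0 &
    forall y, preproj m y -> poly_eval (m := m) p y != 0 -> self_ext_exact y.
Proof.
move=> ex; pose D0 y := lin1_mx (diff0 y); pose D1 y := lin1_mx (diff1 y).
have [h1 h1E] : exists h1, D1 x *m h1 *m D1 x = D1 x.
  by exists (pinvmx (D1 x)); rewrite mulmxKpV.
have /submxP[h0 h0E] : (1%:M - D1 x *m h1 <= D0 x)%MS.
  apply: submx_trans (exact_kermx ex); apply/sub_kermxP.
  by rewrite mulmxBl mul1mx h1E subrr.
have [|p pE] := @polyfun_det _ (fun y => h0 *m D0 y + D1 y *m h1).
  by apply: polymxD; apply: polymxM; try exact: polymxC; [exact: polymx_diff0|exact: polymx_diff1].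
exists p => [|y py]; first by rewrite -pE -h0E subrK det1 oner_eq0.
rewrite -pE -unitfE -[_ \is a _]/(_ \in unitmx) => Psi_unit; apply: kermx_exact.
set K := kermx _; have KD : K *m (h0 *m D0 y + D1 y *m h1) = K *m h0 *m D0 y.
  have KD1 : K *m D1 y = 0 by apply: mulmx_ker.
  by rewrite mulmxDr !mulmxA KD1 mul0mx addr0.
have D0K : (D0 y <= K)%MS by apply/sub_kermxP/diff_mul0.
have rK : (\rank K <= \rank (D0 y))%N.
  by rewrite -(mxrankMfree K (B := h0 *m D0 y + D1 y *m h1)) ?row_free_unit // KD mxrankS ?submxMl.
by rewrite -(mxrank_leqif_sup D0K).2 eqn_leq rK mxrankS.
Qed.
(** The self-duality of the complex under the trace form: tangent vectors pair to
    zero with the fibre directions coming from endomorphisms of T.  By the two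
    relations, the sum telescopes. *)
Lemma tangent_trace x u phi : tangent x u ->
    (forall v, phi v.+1 *m drepT x v = drepT x v *m phi v) ->
  \sum_(0 <= v < m) \tr (drepT u v *m drepB (inner x phi) v) = 0.
Proof.
move=> tu comm.
pose f v := \tr (phi v *m (drepB x v *m drepT u v)).
pose q v := \tr (phi v *m (drepB u v *m drepT x v)).
have trace0 (r : nat) (X : 'M[k]_r) : r = 0%N -> \tr X = 0.
  by move=> r0; rewrite /mxtrace big1 // => i _; have := leq_trans (ltn_ord i) (eq_leq r0).
have fq0 : f 0%N + q 0%N = 0.
  have d0 : d 0%N = 0%N by apply: d_supp.
  by rewrite /f /q (trace0 _ _ d0) (trace0 _ _ d0) addr0.
have fqm : f m + q m = 0.
  have dm := d_top (leqnn m).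
  rewrite /f /q !mulmxA mxtrace_mulC (trace0 _ _ dm) [X in _ + X]mxtrace_mulC.
  by rewrite (trace0 _ _ dm) addr0.
rewrite (eq_big_nat _ _ (F2 := fun v => - ((f v.+1 + q v.+1) - (f v + q v)))).
  by rewrite sumrN (telescope_sumr (fun v => f v + q v)) // fqm fq0 subrr oppr0.
move=> v /andP[_ vm] /=; rewrite mulmxBr linearB /=.
have -> : \tr (drepT u v *m (phi v *m drepB x v)) = f v.
  by rewrite /f mxtrace_mulC mulmxA.
have -> : \tr (drepT u v *m (drepB x v *m phi v.+1)) = f v.+1 + q v.+1 - q v.
  have -> : q v = \tr (phi v.+1 *m (drepT x v *m drepB u v)).
    by rewrite mulmxA comm /q -mulmxA [RHS]mxtrace_mulC mulmxA.
  rewrite /f /q mulmxA mxtrace_mulC -raddfD -mulmxDr.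
  rewrite [drepB x v.+1 *m _ + _]addrC -(tu v vm) mulmxDr raddfD /=.
  by rewrite addrK.
by rewrite !opprB addrA.
Qed.
End Tangent.

(** * Modules over the stratum *)
Section Frame.
Variables (k : fieldType) (n : nat) (s : 'S_n).
Local Notation d := (perm_dim s).
Local Notation m := (2 * n).-1.

Definition active (v : nat) (i : 'I_n) : bool := (i.+1 <= v <= 2 * n - (s i).+1)%N.

Lemma perm_supported : supported m d.
Proof.
move=> v vm; apply: big1 => i _; rewrite /interval_dim.
by have := ltn_ord i; have := ltn_ord (s i); case: andP => // -[]; lia.
Qed.

(** The identity of the component at [v] of M, seen inside the space with one
    basis vector for each interval. *)
Definition active_proj v : 'M[k]_n := \matrix_(i, j) ((i == j) && active v j)%:R.

Lemma active_projL v (A : 'M[k]_n) i j : (active_proj v *m A) i j = (active v i)%:R * A i j.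
Proof.
rewrite mxE (bigD1 i) //= big1 ?addr0 => [|l li]; rewrite mxE; first by rewrite eqxx.
by rewrite eq_sym (negPf li) mul0r.
Qed.

Lemma active_projR v (A : 'M[k]_n) i j : (A *m active_proj v) i j = A i j * (active v j)%:R.
Proof.
rewrite mxE (bigD1 j) //= big1 ?addr0 => [|l lj]; rewrite mxE; first by rewrite eqxx.
by rewrite (negPf lj) mulr0.
Qed.

(** Coordinates identifying the component at [v] with the span of the active
    basis vectors, in which every T_v is the obvious map: a graded
    representation admits a frame when it is isomorphic to M.  They trade matrices
    of varying size for n x n matrices with entries indexed by intervals. *)
Definition frame (T : qrep k d) (P : forall v, 'M[k]_(n, d v)) (R : forall v, 'M[k]_(d v, n)) :=
  forall v, [/\ R v *m P v = 1%:M, P v *m R v = active_proj v & T v = R v.+1 *m P v].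

Let dims v (i : 'I_n) := interval_dim i.+1 (2 * n - (s i).+1) v.

Let sig1_inj v : injective (@tagnat.sig1 n (dims v)).
Proof.
have small i (a : 'I_(dims v i)) : a = 0%N :> nat.
  by case: a => a /=; rewrite /dims /interval_dim; case: (_ && _); case: a.
move=> t t' e; apply: tagnat.sig_inj; move: e; rewrite /tagnat.sig1.
case: (tagnat.sig t) => i a; case: (tagnat.sig t') => j b /= e.
by case: _ / e b => b; congr existT; apply: ord_inj; rewrite !small.
Qed.

Lemma perm_frame : exists P R, frame (perm_rep k s) P R.
Proof.
pose P v : 'M[k]_(n, d v) := \matrix_(i, t) (@tagnat.sig1 n (dims v) t == i)%:R.
exists P, (fun v => (P v)^T) => v; split; apply/matrixP.
- move=> t t'; rewrite !mxE (bigD1 (@tagnat.sig1 n (dims v) t)) //= big1 ?addr0.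
    by rewrite !mxE eqxx mul1r (inj_eq (@sig1_inj v)) eq_sym.
  by move=> i it; rewrite !mxE eq_sym (negPf it) mul0r.
- move=> i j; rewrite !mxE; have [<-|ij] := eqVneq i j; last first.
    rewrite big1 // => t _; rewrite !mxE; case: eqP => [->|]; last by rewrite mul0r.
    by rewrite (negPf ij) mulr0.
  rewrite /=; have [act|act] := boolP (active v i).
    have i0 : (0 < dims v i)%N by rewrite /dims /interval_dim; move: act; rewrite /active => ->.
    rewrite (bigD1 (@tagnat.Rank n (dims v) i (Ordinal i0))) //= big1 ?addr0.
      by rewrite !mxE tagnat.Rank1K eqxx mulr1.
    move=> t tR; rewrite !mxE; case: eqP => [ti|]; last by rewrite mul0r.
    case/eqP: tR; apply: (@sig1_inj v); by rewrite tagnat.Rank1K.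
  rewrite big1 // => t _; rewrite !mxE; case: eqP => [ti|]; last by rewrite mul0r.
  have : (0 < dims v i)%N by rewrite -ti (leq_ltn_trans _ (ltn_ord (tagnat.sig2 t))).
  by rewrite /dims /interval_dim; move: act; rewrite /active => /negPf ->.
move=> t t'; rewrite [LHS]mxE mxE (bigD1 (@tagnat.sig1 n (dims v) t')) //= big1 ?addr0.
  rewrite !mxE eqxx mulr1.
  have conf i j : i = j -> conform_mx (0 : 'M[k]_(dims v.+1 i, dims v j))
    (const_mx 1 : 'M[k]_(dims v.+1 j, dims v j)) = const_mx 1.
    by move=> ->; rewrite conform_mx_id.
  case: eqP => [e|]; last by rewrite mxE.
  by rewrite /interval_rep; rewrite conf // mxE.
by move=> i it; rewrite !mxE [_ t' == i]eq_sym (negPf it) mulr0.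
Qed.

Lemma iso_frame (T : qrep k d) : qrep_iso T (perm_rep k s) -> exists P R, frame T P R.
Proof.
move=> [g [gU gT]]; have [P [R PR]] := perm_frame.
exists (fun v => P v *m g v), (fun v => invmx (g v) *m R v) => v.
have [RP PRv TE] := PR v; split.
- by rewrite mulmxA -(mulmxA _ (R v)) RP mulmx1 mulVmx.
- by rewrite mulmxA -(mulmxA (P v)) mulmxV // mulmx1.
by rewrite mulmxA -(mulmxA _ (R v.+1)) -TE -mulmxA -gT mulmxA mulVmx // mul1mx.
Qed.

Local Notation D := (Dspace k s).
Local Notation A := (Aspace k s).

Lemma active_n i : active n i.
Proof. by rewrite /active; have := ltn_ord i; have := ltn_ord (s i); lia. Qed.

Lemma active_proj_n : active_proj n = 1%:M.
Proof. by apply/matrixP => i j; rewrite !mxE active_n andbT. Qed.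

Lemma nonzero_Xset b i j : b \in D -> b i j != 0 -> (i < j)%N && (s j < s i)%N.
Proof.
move=> /mxspanP bD; apply: contraR => ij; rewrite bD //.
by rewrite inE.
Qed.

Lemma nonzero_Yset a i j : a \in A -> a i j != 0 -> (i <= j)%N && (s j <= s i)%N.
Proof.
move=> /mxspanP aA; apply: contraR => ij; rewrite aA // !inE /=.
apply: contra ij => /orP[/andP[ij sij]|/eqP ->]; last by rewrite !leqnn.
by rewrite (ltnW ij) (ltnW sij).
Qed.

(** The relation makes the (i, j) entry of B_v constant in v as long as both
    intervals are active, in particular along the way to the common vertex n.
    It vanishes if interval i starts too late or interval j ends too early. *)
Lemma fibre_param (B : nat -> 'M[k]_n) :
    (forall v, B v = active_proj v *m B v *m active_proj v.+1) ->
    (forall v, (v < m)%N -> active_proj v.+1 *m B v = B v.+1 *m active_proj v.+1) ->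
  B n \in D /\ forall v, B v = active_proj v *m B n *m active_proj v.+1.
Proof.
move=> Bsupp Bcomm.
have Bout v i j : ~~ (active v i && active v.+1 j) -> B v i j = 0.
  rewrite Bsupp active_projR active_projL negb_and => /orP[] /negPf ->;
    by rewrite ?mul0r ?mulr0.
have step v i j : (v < m)%N -> active v.+1 i -> active v.+1 j -> B v i j = B v.+1 i j.
  move=> vm ai aj; have /matrixP/(_ i j) := Bcomm v vm.
  by rewrite active_projL active_projR ai aj mul1r mulr1.
have up t (i j : 'I_n) : (n + t <= 2 * n - (s i).+1)%N -> (n + t <= 2 * n - (s j).+1)%N ->
    B (n + t)%N i j = B n i j.
  elim: t => [|t IH] ti tj; first by rewrite addn0.
  rewrite addnS -step ?IH //; rewrite /active; have := ltn_ord i; have := ltn_ord j;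
  have := ltn_ord (s i); lia.
have down t (i j : 'I_n) : (t <= n)%N -> (i <= n - t)%N ->
    (j <= n - t)%N -> B (n - t)%N i j = B n i j.
  elim: t => [|t IH] tn ti tj; first by rewrite subn0.
  have e : (n - t = (n - t.+1).+1)%N by lia.
  have ai := active_n i; have aj := active_n j; move: ai aj; rewrite /active => ai aj.
  rewrite step -?e ?IH //; try lia; rewrite /active; lia.
split=> [|v].
  apply/mxspanP => i j; rewrite inE /= negb_and -!leqNgt => /orP[ji|sij].
    rewrite -(down (n - i)%N) //; try by have := ltn_ord i; lia.
    by apply: Bout; rewrite /active; have := ltn_ord i; lia.
  have [ji|ij] := leqP j i.
    rewrite -(down (n - i)%N) //; try by have := ltn_ord i; lia.
    by apply: Bout; rewrite /active; have := ltn_ord i; lia.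
  have := ltn_ord (s j); have := ltn_ord (s i) => si sj.
  rewrite -(up (n - (s j).+1)%N) //; try lia.
  by apply: Bout; rewrite /active; lia.
apply/matrixP => i j; rewrite active_projR active_projL.
have [|out] := boolP (active v i && active v.+1 j); last first.
  by rewrite Bout //; move: out; rewrite negb_and => /orP[] /negPf ->; rewrite ?mul0r ?mulr0.
move=> /andP[ai aj]; rewrite ai aj mul1r mulr1; move: ai aj; rewrite /active => ai aj.
have [vn|nv] := leqP v n; first by rewrite -(down (n - v)%N) ?subKn //; lia.
have e : v = (n + (v - n))%N by lia.
by rewrite e up -?e //; lia.
Qed.

(** The same propagation along the vertices as for the fibre, with the intervals
    compared without the shift by one. *)
Lemma end_param (p : nat -> 'M[k]_n) :
    (forall v, p v = active_proj v *m p v *m active_proj v) ->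
    (forall v, p v.+1 *m active_proj v = active_proj v.+1 *m p v) ->
  p n \in A /\ forall v, p v = active_proj v *m p n *m active_proj v.
Proof.
move=> psupp pcomm.
have pout v i j : ~~ (active v i && active v j) -> p v i j = 0.
  rewrite psupp active_projR active_projL negb_and => /orP[] /negPf ->;
    by rewrite ?mul0r ?mulr0.
have step v i j : active v.+1 i -> active v j -> p v i j = p v.+1 i j.
  move=> ai aj; have /matrixP/(_ i j) := pcomm v.
  by rewrite active_projL active_projR ai aj mul1r mulr1.
have up t (i j : 'I_n) : (n + t <= 2 * n - (s i).+1)%N -> (n + t <= (2 * n - (s j).+1).+1)%N ->
    p (n + t)%N i j = p n i j.
  elim: t => [|t IH] ti tj; first by rewrite addn0.
  rewrite addnS -step ?IH //; rewrite /active; have := ltn_ord i; have := ltn_ord j;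
  have := ltn_ord (s i); lia.
have down t (i j : 'I_n) : (t <= n)%N -> (i <= n - t)%N ->
    (j < n - t)%N -> p (n - t)%N i j = p n i j.
  elim: t => [|t IH] tn ti tj; first by rewrite subn0.
  have e : (n - t = (n - t.+1).+1)%N by lia.
  have ai := active_n i; have aj := active_n j; move: ai aj; rewrite /active => ai aj.
  rewrite step -?e ?IH //; try lia; rewrite /active; lia.
split=> [|v].
  apply/mxspanP => i j; rewrite !inE /= negb_or negb_and -!leqNgt => /andP[+ ij].
  have [lij|lji] := ltnP i j => /= sij; last first.
    have {}lji : (j < i)%N by rewrite ltn_neqAle lji eq_sym (inj_eq val_inj) ij.
    rewrite -(down (n - i)%N) //; try by have := ltn_ord i; lia.
    by apply: pout; rewrite /active; have := ltn_ord i; lia.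
  have {}sij : (s i < s j)%N.
    by rewrite ltn_neqAle sij (inj_eq val_inj) (inj_eq perm_inj) ij.
  have := ltn_ord (s j); have := ltn_ord (s i) => si sj.
  rewrite -(up (n - (s j))%N) //; try lia.
  by apply: pout; rewrite /active; lia.
apply/matrixP => i j; rewrite active_projR active_projL.
have [|out] := boolP (active v i && active v j); last first.
  by rewrite pout //; move: out; rewrite negb_and => /orP[] /negPf ->; rewrite ?mul0r ?mulr0.
move=> /andP[ai aj]; rewrite ai aj mul1r mulr1; move: ai aj; rewrite /active => ai aj.
have [vn|nv] := leqP v n; first by rewrite -(down (n - v)%N) ?subKn //; lia.
have e : v = (n + (v - n))%N by lia.
by rewrite e up -?e //; lia.
Qed.

Lemma active_proj_A v a : a \in A ->
  active_proj v.+1 *m (active_proj v *m a) *m active_proj v =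
  active_proj v.+1 *m (a *m active_proj v.+1) *m active_proj v.
Proof.
move=> aA; apply/matrixP => i j; rewrite !active_projR !active_projL active_projR.
have [->|/(nonzero_Yset aA) ij] := eqVneq (a i j) 0; first by rewrite !(mulr0, mul0r).
case: (boolP (active v.+1 i)) => ai; last by rewrite !mul0r.
case: (boolP (active v j)) => aj; last by rewrite !mulr0.
suff -> : active v i = active v.+1 j by rewrite mulrC [in RHS]mulrC [_ * a i j]mulrC.
by move: ai aj ij; rewrite /active; lia.
Qed.

Lemma active_proj_D v b : b \in D ->
  active_proj v.+1 *m (active_proj v *m b) *m active_proj v.+1 =
  active_proj v.+1 *m (b *m active_proj v.+2) *m active_proj v.+1.
Proof.
move=> bD; apply/matrixP => i j; rewrite !active_projR !active_projL active_projR.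
have [->|/(nonzero_Xset bD) ij] := eqVneq (b i j) 0; first by rewrite !(mulr0, mul0r).
case: (boolP (active v.+1 i)) => ai; last by rewrite !mul0r.
case: (boolP (active v.+1 j)) => aj; last by rewrite !mulr0.
suff -> : active v i = active v.+2 j by rewrite mulrC [in RHS]mulrC [_ * b i j]mulrC.
by move: ai aj ij; rewrite /active; have := ltn_ord (s i); lia.
Qed.

Lemma active_proj_AD v a b : a \in A -> b \in D ->
  active_proj v *m (a *m active_proj v *m b) *m active_proj v.+1 =
  active_proj v *m (a *m b) *m active_proj v.+1.
Proof.
move=> aA bD; apply/matrixP => i l; rewrite !active_projR !active_projL.
case: (boolP (active v i)) => ai; last by rewrite !mul0r.
case: (boolP (active v.+1 l)) => al; last by rewrite !mulr0.
rewrite !mul1r !mulr1 !mxE; apply: eq_bigr => j _; rewrite active_projR.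
have [->|/(nonzero_Yset aA) ij] := eqVneq (a i j) 0; first by rewrite !mul0r.
have [->|/(nonzero_Xset bD) jl] := eqVneq (b j l) 0; first by rewrite !mulr0.
suff -> : active v j by rewrite mulr1.
by move: ai al ij jl; rewrite /active; lia.
Qed.

Lemma active_proj_DA v a b : a \in A -> b \in D ->
  active_proj v *m (b *m active_proj v.+1 *m a) *m active_proj v.+1 =
  active_proj v *m (b *m a) *m active_proj v.+1.
Proof.
move=> aA bD; apply/matrixP => i l; rewrite !active_projR !active_projL.
case: (boolP (active v i)) => ai; last by rewrite !mul0r.
case: (boolP (active v.+1 l)) => al; last by rewrite !mulr0.
rewrite !mul1r !mulr1 !mxE; apply: eq_bigr => j _; rewrite active_projR.
have [->|/(nonzero_Yset aA) jl] := eqVneq (a j l) 0; first by rewrite !mulr0.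
have [->|/(nonzero_Xset bD) ij] := eqVneq (b i j) 0; first by rewrite !mul0r.
suff -> : active v.+1 j by rewrite mulr1.
by move: ai al ij jl; rewrite /active; have := ltn_ord (s i); lia.
Qed.

Lemma D_active_proj b : b \in D -> b *m active_proj n.+1 = b.
Proof.
move=> bD; apply/matrixP => i j; rewrite active_projR.
have [->|/(nonzero_Xset bD) ij] := eqVneq (b i j) 0; first by rewrite mul0r.
suff -> : active n.+1 j by rewrite mulr1.
by move: ij; rewrite /active; have := ltn_ord j; have := ltn_ord (s i); lia.
Qed.

(** Entrywise, U must be the difference of consecutive terms of a sequence that
    vanishes where the intervals are not both active.  Summing from the left
    meets this condition at the left end, summing from the right at the right
    end; one end is unconstrained unless (q, p) is in X, and then the two sums
    agree because the total is zero. *)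
Lemma coboundary (U : nat -> 'M[k]_n) :
    (forall v, U v = active_proj v.+1 *m U v *m active_proj v) ->
    (forall i j, (i, j) \in Xset s -> \sum_(0 <= v < m) U v j i = 0) ->
  exists F : nat -> 'M[k]_n, forall v, U v =
    active_proj v.+1 *m (F v.+1 *m active_proj v.+1 - active_proj v *m F v) *m active_proj v.
Proof.
move=> Usupp total.
have Uout v p q : ~~ (active v.+1 p && active v q) -> U v p q = 0.
  rewrite Usupp active_projR active_projL negb_and => /orP[] /negPf ->;
    by rewrite ?mul0r ?mulr0.
pose F v : 'M[k]_n := \matrix_(p, q) (if (p <= q)%N
  then - \sum_(v <= u < m) U u p q else \sum_(0 <= u < v) U u p q).
exists F => v; apply/matrixP => p q.
rewrite active_projR active_projL mxE [(F v.+1 *m _) p q]active_projR.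
rewrite [(- _ : 'M__) p q]mxE active_projL.
have [|out] := boolP (active v.+1 p && active v q); last first.
  by rewrite Uout //; move: out; rewrite negb_and => /orP[] /negPf ->; rewrite ?mul0r ?mulr0.
move=> /andP[ap aq]; rewrite ap aq mul1r mulr1.
have vm : (v < m)%N by move: ap; rewrite /active; lia.
have diffF : F v.+1 p q - F v p q = U v p q.
  rewrite !mxE; case: leqP => pq.
    by rewrite opprK addrC (big_ltn vm) addrK.
  by rewrite big_nat_recr //= addrAC subrr add0r.
have -> : F v.+1 p q * (active v.+1 q)%:R = F v.+1 p q.
  case: (boolP (active v.+1 q)) => aq'; first by rewrite mulr1.
  have vb : (2 * n - (s q).+1 <= v)%N by move: aq aq'; rewrite /active; lia.
  suff -> : F v.+1 p q = 0 by rewrite mul0r.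
  rewrite mxE; case: leqP => pq.
    rewrite big_nat_cond big1 ?oppr0 // => u /andP[/andP[vu _] _].
    by apply: Uout; rewrite negb_and orbC /active; lia.
  have qp : (q, p) \in Xset s.
    by rewrite inE pq /=; move: ap; rewrite /active; have := ltn_ord (s q); lia.
  rewrite -[RHS](total q p qp) [RHS](big_cat_nat (n := v.+1)) //=.
  rewrite -[LHS]addr0; congr (_ + _).
  rewrite big_nat_cond big1 // => u /andP[/andP[vu _] _].
  by apply: Uout; rewrite negb_and orbC /active; lia.
have -> : (active v p)%:R * F v p q = F v p q.
  case: (boolP (active v p)) => ap'; first by rewrite mul1r.
  have va : (v <= p)%N by move: ap ap'; rewrite /active; lia.
  suff -> : F v p q = 0 by rewrite mulr0.
  rewrite mxE; case: leqP => pq; first by move: aq; rewrite /active; lia.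
  rewrite big_nat_cond big1 // => u /andP[/andP[_ uv] _].
  by apply: Uout; rewrite negb_and /active; lia.
by rewrite diffF.
Qed.

Section WithFrame.
Variables (T : qrep k d) (P : forall v, 'M[k]_(n, d v)) (R : forall v, 'M[k]_(d v, n)).
Hypothesis PR : frame T P R.

Let RP v : R v *m P v = 1%:M. Proof. by have [] := PR v. Qed.
Let PRE v : P v *m R v = active_proj v. Proof. by have [] := PR v. Qed.
Let TE v : T v = R v.+1 *m P v. Proof. by have [] := PR v. Qed.

Let projP v : active_proj v *m P v = P v.
Proof. by rewrite -PRE -mulmxA RP mulmx1. Qed.
Let Rproj v : R v *m active_proj v = R v.
Proof. by rewrite -PRE mulmxA RP mul1mx. Qed.

Lemma frame_eq v w (X Y : 'M[k]_n) :
  active_proj v *m X *m active_proj w = active_proj v *m Y *m active_proj w ->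
  R v *m X *m P w = R v *m Y *m P w.
Proof.
move=> XY; rewrite -(Rproj v) -(projP w) !mulmxA.
by rewrite -!(mulmxA (R v)) XY.
Qed.

Lemma frameK v w (X : 'M[k]_(d v, d w)) : R v *m (P v *m X *m R w) *m P w = X.
Proof. by rewrite !mulmxA RP mul1mx -mulmxA RP mulmx1. Qed.

Lemma frame_supp v w (X : 'M[k]_(d v, d w)) :
  P v *m X *m R w = active_proj v *m (P v *m X *m R w) *m active_proj w.
Proof. by rewrite !mulmxA projP -(mulmxA _ (R w)) Rproj. Qed.

Lemma frame_fibre (B : forall v, 'M[k]_(d v, d v.+1)) :
    (forall v, (v < m)%N -> T v *m B v = B v.+1 *m T v.+1) ->
  exists2 b, b \in D & forall v, B v = R v *m b *m P v.+1.
Proof.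
move=> BT; pose C v := P v *m B v *m R v.+1.
have [|v vm|bD CE] := @fibre_param C; first by move=> v; apply: frame_supp.
  rewrite /C -!PRE !mulmxA -(mulmxA (P v.+1)) -TE -(mulmxA _ (T v)) BT //.
  by rewrite -(mulmxA _ (R v.+2)) -(mulmxA _ _ (R v.+1)) TE !mulmxA.
exists (C n) => // v; rewrite -[LHS](frameK (B v)) -/(C v) (CE v).
by rewrite !mulmxA Rproj -(mulmxA _ (active_proj v.+1)) projP.
Qed.

Lemma frame_end (p : forall v, 'M[k]_(d v)) :
    (forall v, p v.+1 *m T v = T v *m p v) ->
  exists2 a, a \in A & forall v, p v = R v *m a *m P v.
Proof.
move=> pT; pose q v := P v *m p v *m R v.
have [v|v|qA qE] := @end_param q; first exact: frame_supp.
  rewrite /q -!PRE -!mulmxA (mulmxA (R v.+1) (P v)) -TE (mulmxA (p v.+1)) pT.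
  by rewrite -mulmxA TE !mulmxA.
exists (q n) => // v; rewrite -[LHS](frameK (p v)) -/(q v) (qE v).
by rewrite !mulmxA Rproj -(mulmxA _ (active_proj v)) projP.
Qed.

Lemma frame_A_comm a v : a \in A ->
  (R v.+1 *m a *m P v.+1) *m T v = T v *m (R v *m a *m P v).
Proof.
move=> aA; rewrite TE !mulmxA -(mulmxA _ (P v.+1)) PRE -(mulmxA _ (P v) (R v)) PRE.
by have := frame_eq (active_proj_A v aA); rewrite !mulmxA.
Qed.

Lemma frame_D_comm b v : b \in D ->
  T v *m (R v *m b *m P v.+1) = (R v.+1 *m b *m P v.+2) *m T v.+1.
Proof.
move=> bD; rewrite !TE !mulmxA -(mulmxA _ (P v.+2)) PRE -(mulmxA _ (P v) (R v)) PRE.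
by have := frame_eq (active_proj_D v bD); rewrite !mulmxA.
Qed.

Lemma frame_AD a b v : a \in A -> b \in D ->
  (R v *m a *m P v) *m (R v *m b *m P v.+1) = R v *m (a *m b) *m P v.+1.
Proof.
move=> aA bD; rewrite -(frame_eq (active_proj_AD v aA bD)) -PRE !mulmxA.
by [].
Qed.

Lemma frame_DA a b v : a \in A -> b \in D ->
  (R v *m b *m P v.+1) *m (R v.+1 *m a *m P v.+1) = R v *m (b *m a) *m P v.+1.
Proof.
move=> aA bD; rewrite -(frame_eq (active_proj_DA v aA bD)) -PRE !mulmxA.
by [].
Qed.

(** Moving only B, by an element b of D, is a tangent vector, and the
    infinitesimal automorphisms producing it fix T, so they come from A. *)
Lemma exact_ad_onto (B : forall v, 'M[k]_(d v, d v.+1)) :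
    preproj m (DRep T B) -> self_ext_exact m (DRep T B) ->
  exists2 lam, lam \in D & ad_onto (inv_lt s) [set: 'I_n] lam.
Proof.
move=> pB ex; have [lam lamD BE] := @frame_fibre B pB; exists lam => //.
apply/subvP => b; rewrite -Xset_strict => bD.
pose u : drep k d := DRep (fun=> 0) (fun v => R v *m b *m P v.+1).
have [|p [pT pBE]] := ex u.
  by move=> v vm /=; rewrite mul0mx add0r mulmx0 addr0 frame_D_comm.
have [v|a aA pE] := @frame_end p.
  by apply/eqP; rewrite -subr_eq0; have := pT v => /= <-.
have := pBE n; rewrite /= !BE !pE frame_AD // frame_DA //.
move/(congr1 (fun X => P n *m X *m R n.+1)).
have PRR X : P n *m (R n *m X *m P n.+1) *m R n.+1 = X *m active_proj n.+1.
  by rewrite !mulmxA PRE active_proj_n mul1mx -mulmxA PRE.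
rewrite mulmxBr mulmxBl !PRR !D_active_proj //.
- by move=> ->; apply: mem_ad_img; rewrite -Yset_weak.
- by move: aA lamD; rewrite /Aspace /Dspace Xset_strict Yset_weak => aA lamD;
    apply: (strict_weak_mul (@inv_trans _ s)).
by move: aA lamD; rewrite /Aspace /Dspace Xset_strict Yset_weak => aA lamD;
  apply: (weak_strict_mul (@inv_trans _ s)).
Qed.

Section Exactness.
Variables (lam : 'M[k]_n).
Hypotheses (lamD : lam \in D) (onto : ad_onto (inv_lt s) [set: 'I_n] lam).
Let x := @DRep k d T (fun v => R v *m lam *m P v.+1).

Lemma frame_preproj : preproj m x.
Proof. by move=> v _ /=; apply: frame_D_comm. Qed.

Let onto_D b : b \in D -> exists2 a, a \in A & b = a *m lam - lam *m a.
Proof.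
rewrite /Dspace Xset_strict => /(ad_ontoP onto)[a aA <-].
by exists a; rewrite // /Aspace Yset_weak.
Qed.

Let onto_fibre b : b \in D -> exists p : forall v, 'M[k]_(d v),
  (forall v, p v.+1 *m T v = T v *m p v) /\
  (forall v, R v *m b *m P v.+1 = p v *m drepB x v - drepB x v *m p v.+1).
Proof.
move=> /onto_D[a aA ->]; exists (fun v => R v *m a *m P v); split=> v.
  exact: frame_A_comm.
by rewrite /= frame_AD // frame_DA // mulmxBr mulmxBl.
Qed.

(* Matrix units of D are commutators with [lam], so [tangent_trace] applies to
   them. *)
Let trace_pairing u i j : tangent m x u -> (i, j) \in Xset s ->
  \sum_(0 <= v < m) (P v.+1 *m drepT u v *m R v) j i = 0.
Proof.
move=> tu ij; have [p [pT pB]] := onto_fibre (delta_mxspan k ij).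
rewrite -[RHS](tangent_trace perm_supported tu pT); apply: eq_bigr => v _.
rewrite [drepB (inner x p) v]/= -[_ - _ *m p v.+1]pB !mulmxA mxtrace_mulC !mulmxA.
rewrite /mxtrace (bigD1 j) //= [in RHS]big1 => [|l lj]; last first.
  by rewrite mxE big1 // => l' _; rewrite [delta_mx _ _ _ _]mxE (negPf lj) andbF mulr0.
rewrite addr0 [RHS]mxE (bigD1 i) //= big1 => [|l li]; last first.
  by rewrite [delta_mx _ _ _ _]mxE (negPf li) mulr0.
by rewrite addr0 [delta_mx _ _ _ _]mxE !eqxx mulr1.
Qed.

(** By the trace pairing and [coboundary], an infinitesimal automorphism moves T
    as prescribed; what remains is a change of B in the fibre, which is reached
    by surjectivity. *)
Lemma ad_onto_exact : self_ext_exact m x.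
Proof.
move=> u tu; pose U v := P v.+1 *m drepT u v *m R v.
have [v|i j|F FE] := @coboundary U; [exact: frame_supp|exact: trace_pairing|].
pose p0 v := R v *m F v *m P v.
have uT v : drepT u v = drepT (inner x p0) v.
  rewrite -[LHS](frameK (drepT u v)) -/(U v) FE /= /p0 TE.
  rewrite !mulmxA Rproj -(mulmxA _ (active_proj v)) projP mulmxBr mulmxBl -!PRE !mulmxA.
  by [].
have [v vm|b bD bE] := @frame_fibre (fun v => drepB u v - drepB (inner x p0) v).
  have := tu v vm; have := inner_tangent p0 frame_preproj vm; rewrite !uT => e1 e2.
  have := congr2 (fun X Y => X - Y) e2 e1; rewrite [in RHS]opprD [RHS]addrACA subrr addr0.
  by rewrite [in LHS]opprD [LHS]addrACA subrr add0r -mulmxBr -mulmxBl.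
have [p [pT pB]] := onto_fibre bD.
exists (fun v => p0 v + p v); split=> v /=.
  by rewrite uT /= mulmxDl mulmxDr pT opprD addrACA subrr addr0.
rewrite mulmxDl mulmxDr opprD addrACA -pB -bE /=.
by rewrite addrC subrK.
Qed.
End Exactness.
End WithFrame.

(** Otherwise the determinant of [self_ext_exact_open] would vanish on the
    stratum, hence on its closure, but it does not vanish at [x]. *)
Lemma component_exact_ad_onto (x : drep k d) :
    perm_component x -> self_ext_exact m x ->
    (forall lam, lam \in D -> ~ ad_onto (inv_lt s) [set: 'I_n] lam) -> False.
Proof.
move=> [px clx] ex none.
have [p px0 pE] := self_ext_exact_open perm_supported ex.
have : poly_eval (m := m) p x = 0.
  apply: (clx (fun y => poly_eval (m := m) p y = 0)).
    by exists (fun q => q = p) => y; split=> [py q ->|]; [| apply].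
  move=> [T B] [py isoy]; apply/eqP; apply: contraT => py0.
  have [P [R PR]] := iso_frame isoy.
  have [lam lamD onto] := exact_ad_onto PR py (pE _ py py0).
  by case: (none lam lamD).
by move/eqP; rewrite (negPf px0).
Qed.

Lemma ad_onto_component_exact lam : lam \in D -> ad_onto (inv_lt s) [set: 'I_n] lam ->
  exists2 x : drep k d, perm_component x & self_ext_exact m x.
Proof.
move=> lamD onto; have [P [R PR]] := perm_frame.
exists (@DRep k d (perm_rep k s) (fun v => R v *m lam *m P v.+1));
  last exact: ad_onto_exact.
have st : perm_stratum (@DRep k d (perm_rep k s) (fun v => R v *m lam *m P v.+1)).
  split; first exact: frame_preproj.
  by exists (fun v => 1%:M); split=> v; rewrite ?unitmx1 // mul1mx mulmx1.
by split; [case: st | move=> Z _; apply].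
Qed.
End Frame.

Theorem theorem5p11 (k : closedFieldType) (n : nat) (s : 'S_n) :
  (rigid k s <-> smooth s) /\
  (smooth s -> forall F : fieldType,
     (exists lam : 'M[F]_n,
        [/\ lam \in Dspace F s,
            forall p, p \in Xset s -> lam p.1 p.2 = 0 \/ lam p.1 p.2 = 1
          & Ssurjective s lam]) /\
     Ssurjective s (all_ones F s)).
Proof.
have ones_D F : all_ones F s \in Dspace F s.
  by rewrite /Dspace all_ones_zeta Xset_strict zeta_strict.
have ones_onto (F : fieldType) : smooth s ->
    ad_onto (inv_lt s) [set: 'I_n] (all_ones F s).
  by move=> sm; rewrite all_ones_zeta; apply: smooth_ad_onto_zeta.
split; last first.
  move=> sm F; have surj : Ssurjective s (all_ones F s).
    by apply/Ssurjective_ad_onto => //; apply: ones_onto.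
  split=> //; exists (all_ones F s); split=> // p pX; right.
  rewrite all_ones_zeta mxE -Xset_strict -surjective_pairing pX; exact: mulr1n.
split=> [[x [cx vx]]|sm].
  apply: not_obstructed_smooth => obs_s.
  have ex := Ext1_vanishes_exact (perm_supported s) cx.1 vx.
  apply: (component_exact_ad_onto cx ex) => lam; rewrite /Dspace Xset_strict => lamD onto.
  exact: (ad_onto_not_obstructed (@inv_trans _ s) (@inv_ltn _ s) lamD onto obs_s).
have [x cx ex] := ad_onto_component_exact (ones_D k) (ones_onto k sm).
exists x; split=> //; exact: (exact_Ext1_vanishes cx.1 ex).
Qed.
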